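(* (i) If $M$ and $N$ are finitely presented $B_1$-persistence modules and $d_B(M,N)=\epsilon$ (with $\epsilon\in[0,\infty)$), then $M$ and $N$ are $\epsilon$-interleaved. (ii) If $M$ and $N$ are tame $B_1$-persistence modules and $d_B(M,N)=\epsilon$ (with $\epsilon\in[0,\infty)$), then $M$ and $N$ are $(\epsilon+\delta)$-interleaved for any $\delta>0$.
   Context: Fix a field $k$. $B_1=k[\mathbb{R}_{\ge 0}]$ is the monoid ring of $(\mathbb{R}_{\ge 0},+)$ (''polynomials'' in $x$ with non-negative real exponents). A $B_1$-persistence module is a $B_1$-module $M$ with a $k$-vector space decomposition $M=\bigoplus_{a\in\mathbb{R}}M_a$ such that $x^{\alpha}(M_a)\subset M_{a+\alpha}$ for all $a\in\mathbb{R}$, $\alpha\ge 0$; morphisms are module homomorphisms $f$ with $f(M_a)\subset N_a$ for all $a$. For $a\le b$ the transition map $\varphi_M(a,b):M_a\to M_b$ is multiplication by $x^{b-a}$. $M$ is tame if every $M_a$ is finite dimensional. For $v\in\mathbb{R}$, $M(v)_a=M_{a+v}$. $M$ is finitely presented if $M\cong F/\langle R\rangle$ where $F=\bigoplus_{y\in G}B_1(-gr(y))$ for a finite set $G$ with grade function $gr:G\to\mathbb{R}$, and $R\subset F$ is a finite set of homogeneous elements. Interleavings: for $\epsilon\ge 0$, $M(\epsilon)$ has transition maps $\varphi_{M(\epsilon)}(a,b)=\varphi_M(a+\epsilon,b+\epsilon)$; for a morphism $f$, $f(\epsilon)_a=f_{a+\epsilon}$; $S(M,\epsilon):M\to M(\epsilon)$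 is the morphism with $S(M,\epsilon)_a=\varphi_M(a,a+\epsilon)$. $M,N$ are $\epsilon$-interleaved if there are morphisms $f:M\to N(\epsilon)$, $g:N\to M(\epsilon)$ with $g(\epsilon)\circ f=S(M,2\epsilon)$ and $f(\epsilon)\circ g=S(N,2\epsilon)$. Bottleneck distance: write $\bar{\mathbb{R}}=\mathbb{R}\cup\{\pm\infty\}$, $\bar{\mathbb{Z}}=\mathbb{Z}\cup\{\pm\infty\}$, and for $S\subset\bar{\mathbb{R}}^2$ let $S_+=\{(a,b)\in S: a<b\}$. A persistence diagram is a function $D:\bar{\mathbb{R}}^2_+\to\mathbb{Z}_{\ge 0}$, with support $\mathrm{supp}(D)$. A multibijection between diagrams $D_1,D_2$ is a function $\gamma:\mathrm{supp}(D_1)\times\mathrm{supp}(D_2)\to\mathbb{Z}_{\ge0}$ such that for each $x\in \mathrm{supp}(D_1)$ only finitely many $y$ have $\gamma(x,y)\neq 0$ and $D_1(x)=\sum_y\gamma(x,y)$, and symmetrically for each $y\in\mathrm{supp}(D_2)$ only finitely many $x$ have $\gamma(x,y)\ne 0$ and $D_2(y)=\sum_x\gamma(x,y)$. Let $\mathcal{L}(D_1,D_2)$ be the set of triples $(D_1',D_2',\gamma)$ with $D_1'\le D_1$, $D_2'\le D_2$ persistence diagrams and $\gamma$ a multibijection between $D_1'$ and $D_2'$. With $\|\cdot\|_\infty$ the $\ell^\infty$-norm on the plane extended to $\bar{\mathbb{R}}^2$ (equal infinite coordinates are at distance $0$, a finite and an infinite one at distance $\infty$), $$d_B(D_1,D_2)=\inf_{(D_1',D_2',\gamma)\in\mathcal{L}(D_1,D_2)}\max\Big(\sup_{(a,b)\in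 \mathrm{supp}(D_1-D_1')\cup\mathrm{supp}(D_2-D_2')}\tfrac12(b-a),\ \sup_{(x,y)\in\mathrm{supp}(\gamma)}\|y-x\|_\infty\Big).$$ A grid function is a strictly increasing $t:\mathbb{Z}\to\mathbb{R}$ whose image has no accumulation point; it extends to $\bar t:\bar{\mathbb{Z}}\to\bar{\mathbb{R}}$ by $\bar t(\pm\infty)=\pm\infty$. It is an $\epsilon$-cover if every real number is within $\epsilon$ of $\mathrm{im}(t)$. For $M$ tame, the $t$-discretization of $M$ is the $\mathbb{Z}$-graded $k[x]$-module with degree-$z$ part $M_{t(z)}$ and transition maps $\varphi_M(t(y),t(z))$; by the structure theorem it is a direct sum of interval modules with $D(a,b)$ copies of the interval module supported on $\{z\in\mathbb{Z}:a\le z<b\}$, for a unique $D:\bar{\mathbb{Z}}^2_+\to\mathbb{Z}_{\ge0}$. The diagram of the $t$-discretization is the persistence diagram supported on the image of $\mathrm{supp}(D)$ under $(a,b)\mapsto(\bar t(a),\bar t(b))$ and taking the value $D(a,b)$ at $(\bar t(a),\bar t(b))$. The persistence diagram $D_M$ of $M$ is the limit (in $d_B$) of the diagrams of the $t_i$-discretizations of $M$, for $\{t_i\}_{i\ge1}$ any sequence of grid functions with $t_i$ a $1/2^i$-cover (it is known that the limit exists and is independent of the sequence). $d_B(M,N):=d_B(D_M,D_N)$. *)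

(* Defs.v *)
From HB Require Import structures.
From mathcomp Require Import all_boot all_order all_algebra.
From mathcomp Require Import all_classical all_reals all_analysis.
(* The notations of monalg clash with those of MathComp-Analysis, so it is
   imported without them. *)
From mathcomp Require monalg.
Import -(notations) monalg.

Set Implicit Arguments.
Unset Strict Implicit.
Unset Printing Implicit Defensive.

Import Order.TTheory GRing.Theory Num.Theory numFieldNormedType.Exports.
Local Open Scope classical_set_scope.
Local Open Scope ring_scope.

Definition expo (R : realType) : Type := {nonneg R}.

HB.instance Definition _ (R : realType) := Choice.on (expo R).

Section ExpoMonoid.
Variable R : realType.

Definition expo0 : expo R := 0%:nng.
Definition expoD (x y : expo R) : expo R := (x%:num + y%:num)%:nng.

Lemma expo_inj (x y : expo R) : x%:num = y%:num -> x = y.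
Proof. by move=> xy; apply: val_inj. Qed.

Lemma expoDA : associative expoD.
Proof. by move=> x y z; apply: expo_inj => /=; rewrite addrA. Qed.

Lemma expo0D : left_id expo0 expoD.
Proof. by move=> x; apply: expo_inj => /=; rewrite add0r. Qed.

Lemma expoD0 : right_id expo0 expoD.
Proof. by move=> x; apply: expo_inj => /=; rewrite addr0. Qed.

Lemma expoD_eq0 (x y : expo R) : expoD x y = expo0 -> x = expo0 /\ y = expo0.
Proof.
move=> /(congr1 (fun z : expo R => z%:num)) /= /eqP.
rewrite paddr_eq0 // => /andP[/eqP x0 /eqP y0].
by split; apply: expo_inj.
Qed.

Lemma expoDC : commutative expoD.
Proof. by move=> x y; apply: expo_inj => /=; rewrite addrC. Qed.

HB.instance Definition _ := monalg.Choice_isMonomialDef.Build (expo R)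
  expoDA expo0D expoD0 expoD_eq0.
HB.instance Definition _ := monalg.MonomialDef_isConomialDef.Build (expo R)
  expoDC.

End ExpoMonoid.

Definition B1 (k : fieldType) (R : realType) : comNzRingType :=
  monalg.malg (expo R) k.

Definition coefB (k : fieldType) (R : realType) (al : expo R) (p : B1 k R) : k :=
  monalg.mcoeff al p.

Definition constB (k : fieldType) (R : realType) (c : k) : B1 k R :=
  monalg.mkmalgU (expo0 R) c.

Definition xpow (k : fieldType) (R : realType) (al : expo R) : B1 k R :=
  monalg.mkmalgU al 1.

(* [pm_span] and [pm_indep] say that the carrier is the internal direct sum of
   its homogeneous parts. *)
Record persMod (k : fieldType) (R : realType) := PersMod {
  pm_carrier :> lmodType (B1 k R);
  pm_part : R -> set pm_carrier;
  pm_part0 : forall a, pm_part a 0;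
  pm_partD : forall a m n, pm_part a m -> pm_part a n -> pm_part a (m + n);
  pm_partZ : forall a (c : k) m, pm_part a m -> pm_part a (constB R c *: m);
  pm_span : forall m, exists (s : seq R) (c : R -> pm_carrier),
    (forall a, pm_part a (c a)) /\ m = \sum_(a <- s) c a;
  pm_indep : forall (s : seq R) (c : R -> pm_carrier), uniq s ->
    (forall a, pm_part a (c a)) -> \sum_(a <- s) c a = 0 ->
    forall a, a \in s -> c a = 0;
  pm_xpow : forall (al : expo R) a m,
    pm_part a m -> pm_part (a + al%:num) (xpow k al *: m) }.

Record pmor (k : fieldType) (R : realType) (M N : persMod k R) := PMor {
  pmor_fun :> {linear M -> N};
  pmor_part : forall a m, pm_part a m -> pm_part a (pmor_fun m) }.

(* The map phi_M(a, b), as a map on the whole of M. *)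
Definition phi (k : fieldType) (R : realType) (M : persMod k R) (a b : R)
    (ab : a <= b) (m : M) : M :=
  xpow k (NngNum (etrans (subr_ge0 a b) ab)) *: m.

Definition tame (k : fieldType) (R : realType) (M : persMod k R) : Prop :=
  forall a, exists (n : nat) (e : 'I_n -> M),
    (forall i, pm_part a (e i)) /\
    forall m, pm_part a m ->
      exists c : 'I_n -> k, m = \sum_i constB R (c i) *: e i.

Section Shift.
Variables (k : fieldType) (R : realType).

Section ShiftModule.
Variables (M : persMod k R) (v : R).

Definition shift_part (a : R) : set M := pm_part (a + v).

Lemma shift_span (m : M) : exists (s : seq R) (c : R -> M),
  (forall a, shift_part a (c a)) /\ m = \sum_(a <- s) c a.
Proof.
have [s [c [hc ->]]] := pm_span m.
exists [seq a - v | a <- s], (fun a => c (a + v)); split.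
  by move=> a; apply: hc.
by rewrite big_map; apply: eq_bigr => a _; rewrite subrK.
Qed.

Lemma shift_indep (s : seq R) (c : R -> M) : uniq s ->
  (forall a, shift_part a (c a)) -> \sum_(a <- s) c a = 0 ->
  forall a, a \in s -> c a = 0.
Proof.
move=> us hc sum0 a sa.
have := @pm_indep _ _ M [seq b + v | b <- s] (fun b => c (b - v)).
move=> /(_ _ _ _ (a + v)); rewrite addrK; apply.
- by rewrite map_inj_uniq //; apply: addIr.
- by move=> b; have := hc (b - v); rewrite /shift_part subrK.
- by rewrite big_map -[RHS]sum0; apply: eq_bigr => b _; rewrite addrK.
- exact: (map_f (fun b => b + v)).
Qed.

Lemma shift_xpow (al : expo R) a (m : M) :
  shift_part a m -> shift_part (a + al%:num) (xpow k al *: m).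
Proof. by move=> am; rewrite /shift_part addrAC; apply: pm_xpow. Qed.

Definition shift : persMod k R :=
  @PersMod k R M shift_part (fun a => pm_part0 M (a + v))
    (fun a => @pm_partD _ _ M (a + v)) (fun a => @pm_partZ _ _ M (a + v))
    shift_span shift_indep shift_xpow.

End ShiftModule.

Definition shift_mor (M N : persMod k R) (f : pmor M N) (v : R) :
    pmor (shift M v) (shift N v) :=
  @PMor k R (shift M v) (shift N v) (pmor_fun f)
    (fun a m => @pmor_part _ _ _ _ f (a + v) m).

(* S(M, eps) : M -> M(eps) *)
Definition smoothing (M : persMod k R) (eps : expo R) :
    pmor M (shift M eps%:num) :=
  @PMor k R M (shift M eps%:num) (GRing.scale (xpow k eps) : {linear M -> M})
    (@pm_xpow _ _ M eps).

(* The codomains M(eps)(eps) and M(2 eps) have the same underlying module M, so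
   the two composites are compared as functions to M. *)
Definition interleaved (eps : expo R) (M N : persMod k R) : Prop :=
  exists (f : pmor M (shift N eps%:num)) (g : pmor N (shift M eps%:num)),
    (forall m : M,
       shift_mor g eps%:num (f m) = smoothing M (expoD eps eps) m :> M) /\
    (forall n : N,
       shift_mor f eps%:num (g n) = smoothing N (expoD eps eps) n :> N).

End Shift.

Section FreeModule.
Variables (k : fieldType) (R : realType) (G : finType) (gr : G -> R).

Notation F := {ffun G -> (B1 k R)^o}.

(* The y-component of a homogeneous element of degree a lies in B1(- gr y)_a,
   i.e. it is a scalar multiple of x^(a - gr y) if gr y <= a, and 0 otherwise. *)
Definition free_part (a : R) : set F :=
  [set v | forall (y : G) (al : expo R),
     al%:num != a - gr y -> coefB al (v y) = 0].

Lemma free_part0 a : free_part a 0.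
Proof. by move=> y al _; rewrite ffunE /coefB monalg.mcoeff0. Qed.

Lemma free_partD a v w : free_part a v -> free_part a w -> free_part a (v + w).
Proof.
move=> hv hw y al ha.
by rewrite ffunE /coefB monalg.mcoeffD [X in X + _]hv // [X in _ + X]hw // addr0.
Qed.

Lemma free_partZ a (c : k) v : free_part a v -> free_part a (constB R c *: v).
Proof.
move=> hv y al ha; rewrite ffunE /coefB /constB.
by rewrite [monalg.mcoeff _ _]monalg.mcoeffCM [X in _ * X]hv // mulr0.
Qed.

Lemma free_xpow (al : expo R) a v :
  free_part a v -> free_part (a + al%:num) (xpow k al *: v).
Proof.
move=> hv y be hb; rewrite ffunE /coefB /xpow.
rewrite [monalg.mcoeff _ _](monalg.mcoeffMlw _ monalg.msuppU_le (finmap.fsubset_refl _)).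
rewrite finmap.big_seq_fset1 big1_seq // => ga _.
have [|ne] := eqVneq; last by rewrite mulr0n.
move=> albe; rewrite [X in _ * X]hv ?mulr0 ?mul0rn //.
apply: contraNneq hb => hga.
by rewrite -albe /= hga addrCA addrA.
Qed.

Lemma free_span v : exists (s : seq R) (c : R -> F),
  (forall a, free_part a (c a)) /\ v = \sum_(a <- s) c a.
Proof.
pose U y al : B1 k R := monalg.mkmalgU al (coefB al (v y)).
pose S y : seq (expo R) :=
  finmap.enum_fset (monalg.msupp (v y : monalg.malg (expo R) k)).
pose s : seq R := undup (flatten
  [seq [seq al%:num + gr y | al <- S y] | y <- enum G]).
exists s, (fun a => [ffun y =>
  \sum_(al <- S y | al%:num == a - gr y) U y al]); split.
  move=> a y al ha; rewrite ffunE /coefB raddf_sum big1_seq // => be /andP[/eqP hb _].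
  rewrite /= monalg.mcoeffU; case: eqVneq => // bal.
  by move: ha; rewrite -bal hb eqxx.
apply/ffunP => y; rewrite sum_ffunE.
under eq_bigr do rewrite ffunE big_mkcond /=.
rewrite exchange_big /= [LHS]monalg.monalgE big_seq [RHS]big_seq.
apply: eq_bigr => al hal.
rewrite -big_mkcond /= (eq_bigl (pred1 (al%:num + gr y))); last first.
  by move=> a; rewrite /= eq_sym subr_eq.
rewrite -big_filter filter_pred1_uniq ?undup_uniq ?big_seq1 //.
rewrite mem_undup; apply/flattenP; exists [seq al%:num + gr y | al <- S y].
  by apply/mapP; exists y; rewrite ?mem_enum.
exact: (map_f (fun al : expo R => al%:num + gr y)).
Qed.

Lemma free_indep (s : seq R) (c : R -> F) : uniq s ->
  (forall a, free_part a (c a)) -> \sum_(a <- s) c a = 0 ->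
  forall a, a \in s -> c a = 0.
Proof.
move=> us hc sum0 a sa; apply/ffunP => y; rewrite ffunE.
apply/monalg.malgP => al; rewrite monalg.mcoeff0.
have [hal|] := eqVneq (al%:num) (a - gr y); last by move/hc.
have := congr1 (fun v : F => coefB al (v y)) sum0.
rewrite sum_ffunE [X in _ = coefB _ X]ffunE /coefB monalg.mcoeff0 raddf_sum.
rewrite (bigD1_seq a) //= big1_seq ?addr0 // => b /andP[ba _].
by apply: hc; rewrite hal (can_eq (subrK _)) eq_sym.
Qed.

Definition freeMod : persMod k R :=
  @PersMod k R F free_part free_part0 free_partD free_partZ
    free_span free_indep free_xpow.

End FreeModule.

Definition submod_gen (k : fieldType) (R : realType) (M : lmodType (B1 k R))
    (n : nat) (r : 'I_n -> M) : set M :=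
  [set m | exists c : 'I_n -> B1 k R, m = \sum_i c i *: r i].

(* An isomorphism F / <r> -> M is the same thing as a surjective morphism
   F -> M with kernel <r>. *)
Definition finitely_presented (k : fieldType) (R : realType)
    (M : persMod k R) : Prop :=
  exists (G : finType) (gr : G -> R) (n : nat) (r : 'I_n -> freeMod k gr),
    (forall i, exists a, pm_part a (r i)) /\
    exists p : pmor (freeMod k gr) M,
      (forall m, exists v, p v = m) /\
      (forall v, p v = 0 <-> submod_gen r v).

(* The ordered pairs a < b of extended elements of T (T = R or int). *)
Definition upper (T : numDomainType) : Type :=
  {p : \bar T * \bar T | (p.1 < p.2)%E}.

HB.instance Definition _ (T : numDomainType) := Choice.on (upper T).

Definition diagram (T : numDomainType) : Type := upper T -> nat.

Definition dsupp (T : numDomainType) (D : diagram T) : set (upper T) :=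
  [set x | D x != 0%N].

(* gam is extended by zero outside dsupp D1 x dsupp D2. *)
Record multibijection (T : numDomainType) (D1 D2 : diagram T)
    (gam : upper T -> upper T -> nat) : Prop := {
  mb_supp : forall x y, gam x y != 0%N -> dsupp D1 x /\ dsupp D2 y;
  mb_finl : forall x, dsupp D1 x -> finite_set [set y | gam x y != 0%N];
  mb_suml : forall x, dsupp D1 x -> D1 x = \sum_(y \in dsupp D2) gam x y;
  mb_finr : forall y, dsupp D2 y -> finite_set [set x | gam x y != 0%N];
  mb_sumr : forall y, dsupp D2 y -> D2 y = \sum_(x \in dsupp D1) gam x y }.

Section Bottleneck.
Variable R : realType.
Local Open Scope ereal_scope.

Definition edist_bar (x y : \bar R) : \bar R :=
  if x == y then 0 else `|x - y|.

Definition linf (p q : \bar R * \bar R) : \bar R :=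
  maxe (edist_bar p.1 q.1) (edist_bar p.2 q.2).

(* Supremum in [0, +oo], so that the empty set has supremum 0. *)
Definition esup0 (A : set (\bar R)) : \bar R := ereal_sup (0 |` A).

Definition matching_cost (D1 D2 D1' D2' : diagram R)
    (gam : upper R -> upper R -> nat) : \bar R :=
  maxe
    (esup0 [set (2^-1)%:E * ((val p).2 - (val p).1) | p in
       dsupp (fun x => D1 x - D1' x)%N `|` dsupp (fun x => D2 x - D2' x)%N])
    (esup0 [set linf (val p.1) (val p.2) | p in
       [set p : upper R * upper R | gam p.1 p.2 != 0%N]]).

Definition bottleneck (D1 D2 : diagram R) : \bar R :=
  ereal_inf [set c | exists (D1' D2' : diagram R) gam,
    [/\ (forall x, D1' x <= D1 x)%N, (forall x, D2' x <= D2 x)%N,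
        multibijection D1' D2' gam & c = matching_cost D1 D2 D1' D2' gam]].

End Bottleneck.

Record grid (R : realType) := Grid {
  grid_fun :> int -> R;
  grid_incr : forall y z : int, y < z -> grid_fun y < grid_fun z;
  grid_discrete : limit_point (range grid_fun) = set0 }.

Lemma grid_le (R : realType) (t : grid R) (y z : int) : y <= z -> t y <= t z.
Proof. by rewrite le_eqVlt => /predU1P[->//|/grid_incr/ltW]. Qed.

Definition is_cover (R : realType) (eps : R) (t : grid R) : Prop :=
  forall x : R, exists z : int, `|x - t z| <= eps.

(* The Z-graded direct sum of D(a, b) copies, for each (a, b), of the interval
   module supported on a <= z < b: its elements of degree z are the finitely
   supported families of scalars indexed by the copies whose interval
   contains z. *)
Section IntervalSum.
Variables (k : fieldType) (D : diagram int).

Definition bar_index : Type := {p : upper int & 'I_(D p)}.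

Definition alive (i : bar_index) (z : int) : bool :=
  ((val (tag i)).1 <= z%:E)%E && (z%:E < (val (tag i)).2)%E.

Definition isum_part (z : int) : set (bar_index -> k) :=
  [set v | finite_set [set i | v i != 0] /\ forall i, ~~ alive i z -> v i = 0].

(* The transition map from any degree y <= z to degree z. *)
Definition isum_trans (z : int) (v : bar_index -> k) : bar_index -> k :=
  fun i => if alive i z then v i else 0.

End IntervalSum.

(* The t-discretization, with degree z part M_(t z) and transition maps
   phi_M(t y, t z), is isomorphic to the sum of interval modules given by D. *)
Definition discretization_decomposes (k : fieldType) (R : realType)
    (M : persMod k R) (t : grid R) (D : diagram int) : Prop :=
  exists theta : int -> (bar_index D -> k) -> M,
    [/\ forall z, set_bij (@isum_part k D z) (@pm_part _ _ M (t z)) (theta z),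
        forall z (c : k) v w, isum_part z v -> isum_part z w ->
          theta z (fun i => c * v i + w i)
          = constB R c *: theta z v + theta z w &
        forall y z (yz : y <= z) v, isum_part y v ->
          theta z (isum_trans z v) = phi (grid_le t yz) (theta y v)].

Definition discretization_diagram (k : fieldType) (R : realType)
    (M : persMod k R) (t : grid R) (E : diagram R) : Prop :=
  exists D : diagram int, discretization_decomposes M t D /\
    (forall (p : upper int) (q : upper R),
       val q = (er_map t (val p).1, er_map t (val p).2) -> E q = D p) /\
    (forall q : upper R, dsupp E q ->
       exists2 p, dsupp D p &
         val q = (er_map t (val p).1, er_map t (val p).2)).

(* D is the limit in the bottleneck distance of the diagrams of the
   discretizations; such a D is determined up to bottleneck distance 0. *)
Definition persistence_diagram (k : fieldType) (R : realType)
    (M : persMod k R) (D : diagram R) : Prop :=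
  forall t : nat -> grid R, (forall i, (0 < i)%N -> is_cover (2^-1 ^+ i) (t i)) ->
  exists E : nat -> diagram R,
    (forall i, (0 < i)%N -> discretization_diagram M (t i) (E i)) /\
    (bottleneck (E i) D @[i --> \oo] --> 0%E).

(* Main.v *)
(** For part (ii), discretize M and N along a common fine uniform grid.  A
    bottleneck distance below c yields a partial bijection between individual
    bars (not just a multibijection of points) that moves endpoints by at most c
    and leaves only bars of length at most 2c unmatched; such matchings compose,
    through D_M and D_N, to one between the bars of the two discretizations.
    Sending each bar to its partner interleaves the discretizations, and rounding
    degrees up to the grid interleaves M and N, at the cost of the mesh.

    For part (i), the transition maps of a finitely presented module are
    bijective between consecutive grades of generators and relations.  Since
    there are finitely many such grades, an (eps + d)-interleaving with d small
    can be pulled back to an eps-interleaving at the critical grades, and then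
    extended to all degrees. *)

Require Import Defs.
From HB Require Import structures.
From mathcomp Require Import all_boot all_order all_algebra.
From mathcomp Require Import all_classical all_reals all_analysis.
From mathcomp Require Import zify ring lra.
From mathcomp Require monalg.
Import -(notations) monalg.
Import Order.TTheory GRing.Theory Num.Theory numFieldNormedType.Exports.
Local Open Scope classical_set_scope.
Local Open Scope ring_scope.

Set Implicit Arguments.
Unset Strict Implicit.
Unset Printing Implicit Defensive.

(** * Homogeneous elements and graded maps *)

Section Scalars.
Variables (k : fieldType) (R : realType).

Lemma constB1 : constB R (1 : k) = 1.
Proof. by []. Qed.

Lemma constBD (c d : k) : constB R (c + d) = constB R c + constB R d.
Proof. exact: monalg.monalgUD. Qed.

Lemma constBN1 : constB R (-1 : k) = -1.
Proof. exact: monalg.monalgUN. Qed.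

Lemma mkmalgUM (c d : k) (al be : expo R) :
  mkmalgU al c * mkmalgU be d = mkmalgU (expoD al be) (c * d) :> B1 k R.
Proof. exact: (@monalg.fgmulUU (expo R) k c d al be). Qed.

Lemma xpow_expoD (al be : expo R) :
  xpow k (expoD al be) = xpow k al * xpow k be.
Proof. by rewrite [RHS]mkmalgUM mulr1. Qed.

Lemma constB_xpow (c : k) (al : expo R) : mkmalgU al c = constB R c * xpow k al.
Proof. by rewrite [RHS]mkmalgUM mulr1 [expoD _ _]expo0D. Qed.

End Scalars.

Lemma le_maxl0 (R : realType) (r : R) : 0 <= Num.max 0 r.
Proof. by rewrite le_max lexx. Qed.

(* Monomials indexed by all of [R]: [xp r] is [x^r] for [0 <= r], and [1] for
   the junk values [r < 0]. *)
HB.lock Definition xp (k : fieldType) (R : realType) (r : R) : B1 k R :=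
  xpow k (NngNum (le_maxl0 r)).

Section Monomials.
Variables (k : fieldType) (R : realType).

Lemma xpowE (al : expo R) : xpow k al = xp k al%:num.
Proof. by rewrite unlock; congr xpow; apply: expo_inj => /=; rewrite max_r. Qed.

Lemma xpD (r s : R) : 0 <= r -> 0 <= s -> xp k (r + s) = xp k r * xp k s.
Proof.
move=> r0 s0; rewrite unlock -xpow_expoD; congr xpow; apply: expo_inj => /=.
by rewrite !max_r // addr_ge0.
Qed.

Lemma B1_ind (P : B1 k R -> Prop) :
  P 0 -> (forall p q, P p -> P q -> P (p + q)) ->
  (forall c r, 0 <= r -> P (constB R c * xp k r)) -> forall p, P p.
Proof.
move=> P0 PD PU p; rewrite [p]monalg.monalgE; apply: big_ind => // al _.
by rewrite constB_xpow xpowE; apply: PU.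
Qed.

End Monomials.

Lemma big_uniq_support (V : zmodType) (T : eqType) (s s' : seq T) (F : T -> V) :
  uniq s -> uniq s' -> {subset s <= s'} -> (forall a, a \notin s -> F a = 0) ->
  \sum_(a <- s') F a = \sum_(a <- s) F a.
Proof.
move=> us us' ss' F0; rewrite (bigID (mem s)) /= [X in _ + X]big1 // addr0.
rewrite -big_filter; apply: perm_big; apply: uniq_perm => //.
  exact: filter_uniq.
by move=> a; rewrite mem_filter; case: (boolP (a \in s)) => //= /ss' ->.
Qed.

(** * Homogeneous components of an element *)

Section Components.
Variables (k : fieldType) (R : realType).
Implicit Types M N : persMod k R.

Lemma pm_partN M a (m : M) : pm_part a m -> pm_part a (- m).
Proof. by move=> /(pm_partZ (-1)); rewrite constBN1 scaleN1r. Qed.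

Lemma pm_partB M a (m n : M) : pm_part a m -> pm_part a n -> pm_part a (m - n).
Proof. by move=> am /pm_partN; apply: pm_partD. Qed.

Lemma pm_part_xp M (a b : R) (m : M) :
  a <= b -> pm_part a m -> pm_part b (xp k (b - a) *: m).
Proof.
move=> ab am; have ba0 : 0 <= b - a by rewrite subr_ge0.
by have := pm_xpow (NngNum ba0) am; rewrite xpowE /= addrC subrK.
Qed.

Lemma phiE M (a b : R) (ab : a <= b) (m : M) : phi ab m = xp k (b - a) *: m.
Proof. by rewrite /phi xpowE. Qed.

(** Since [c] vanishes off [s], it depends on [m] alone and not on the choice of the list [s]. *)
Definition decomposes M (m : M) (s : seq R) (c : R -> M) : Prop :=
  [/\ uniq s, forall a, pm_part a (c a), forall a, a \notin s -> c a = 0 &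
      m = \sum_(a <- s) c a].

Lemma decomposition_exists M (m : M) : exists sc, decomposes m sc.1 sc.2.
Proof.
have [s [c [hc ->]]] := pm_span m.
(* [pm_span] may list a degree repeatedly, so [c a] is multiplied by its number of occurrences,
   which is zero off [s]. *)
exists (undup s, fun a => iterop (count_mem a s) +%R (c a) 0); split => /=.
- exact: undup_uniq.
- move=> a; rewrite Monoid.iteropE; elim: (count_mem a s) => [|n IHn] /=.
    exact: pm_part0.
  exact: pm_partD.
- move=> a; rewrite mem_undup => /count_memPn ->.
  by [].
- by rewrite big_undup_iterop_count.
Qed.

Lemma decomposes_widen M (m : M) s s' c : decomposes m s c -> uniq s' ->
  {subset s <= s'} -> decomposes m s' c.
Proof.
move=> [us hc c0 ->] us' ss'; split => //.
  by move=> a as'; apply: c0; apply: contra as' => /ss'.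
by rewrite (big_uniq_support us us' ss').
Qed.

Lemma decomposes_unique M (m : M) s s' c c' :
  decomposes m s c -> decomposes m s' c' -> c =1 c'.
Proof.
(* Adding [a] to the common list lets [pm_indep] be applied in degree [a] even when neither list
   contains it. *)
move=> dc dc' a; pose u := undup (a :: s ++ s').
have uu : uniq u := undup_uniq _.
have su : {subset s <= u}.
  by move=> b bs; rewrite mem_undup inE mem_cat bs orbT.
have su' : {subset s' <= u}.
  by move=> b bs; rewrite mem_undup inE mem_cat bs !orbT.
have [_ hc _ em] := decomposes_widen dc uu su.
have [_ hc' _ em'] := decomposes_widen dc' uu su'.
apply/eqP; rewrite -subr_eq0; apply/eqP.
apply: (@pm_indep _ _ M u (fun b => c b - c' b)) => //.
- by move=> b; apply: pm_partB.
- by rewrite sumrB -em -em' subrr.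
- by rewrite mem_undup inE eqxx.
Qed.

Definition supp M (m : M) : seq R := (projT1 (cid (decomposition_exists m))).1.
Definition hcomp M (m : M) : R -> M :=
  (projT1 (cid (decomposition_exists m))).2.

Lemma decomposes_comp M (m : M) : decomposes m (supp m) (hcomp m).
Proof. exact: (projT2 (cid (decomposition_exists m))). Qed.

Lemma hcompE M (m : M) s c : decomposes m s c -> hcomp m =1 c.
Proof. exact/decomposes_unique/decomposes_comp. Qed.

Lemma hcomp_part M (m : M) a : pm_part a (hcomp m a).
Proof. by have [] := decomposes_comp m. Qed.

Lemma decomposes_hom M a (m : M) : pm_part a m ->
  decomposes m [:: a] (fun b => if b == a then m else 0).
Proof.
move=> am; split => //.
- by move=> b; case: eqP => [->//|_]; apply: pm_part0.
- by move=> b; rewrite inE => /negPf ->.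
- by rewrite big_seq1 eqxx.
Qed.

Lemma hcomp_hom M a b (m : M) :
  pm_part a m -> hcomp m b = if b == a then m else 0.
Proof. by move=> /decomposes_hom/hcompE ->. Qed.

Lemma decomposesD M (m n : M) s c d :
  decomposes m s c -> decomposes n s d ->
  decomposes (m + n) s (fun a => c a + d a).
Proof.
move=> [us hc c0 ->] [_ hd d0 ->]; split => //.
- by move=> a; apply: pm_partD.
- by move=> a as_; rewrite c0 // d0 // addr0.
- by rewrite big_split.
Qed.

Lemma decomposes_common M (m n : M) :
  exists s, decomposes m s (hcomp m) /\ decomposes n s (hcomp n).
Proof.
exists (undup (supp m ++ supp n)).
split; apply: decomposes_widen (decomposes_comp _) (undup_uniq _) _ => a ha;
  by rewrite mem_undup mem_cat ha ?orbT.
Qed.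

Lemma hcompD M (m n : M) a : hcomp (m + n) a = hcomp m a + hcomp n a.
Proof.
have [s [dm dn]] := decomposes_common m n.
exact: (hcompE (decomposesD dm dn)).
Qed.

Lemma decomposesZ M (m : M) s c (x : k) (r : R) :
  0 <= r -> decomposes m s c ->
  decomposes ((constB R x * xp k r) *: m) [seq a + r | a <- s]
    (fun a => (constB R x * xp k r) *: c (a - r)).
Proof.
move=> r0 [us hc c0 ->]; split.
- by rewrite map_inj_uniq //; apply: addIr.
- move=> a; rewrite -scalerA; apply: pm_partZ.
  have := @pm_part_xp _ (a - r) a _ _ (hc (a - r)).
  by rewrite subKr; apply; rewrite gerBl.
- move=> a as_; rewrite c0 ?scaler0 //; apply: contra as_ => as_.
  by apply/mapP; exists (a - r); rewrite ?subrK.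
- by rewrite scaler_sumr big_map; apply: eq_bigr => a _; rewrite addrK.
Qed.

End Components.

(** * Maps given degree by degree and the morphisms they define *)

Section GradedMaps.
Variables (k : fieldType) (R : realType).
Implicit Types M N : persMod k R.

(* A morphism M -> N(e), given degree by degree; [f a] is only meaningful on the
   part of degree [a]. *)
Record gradedmap (e : R) M N (f : R -> M -> N) : Prop := {
  gm_part : forall a m, pm_part a m -> pm_part (a + e) (f a m);
  gm_linear : forall a (c : k) m n, pm_part a m -> pm_part a n ->
    f a (constB R c *: m + n) = constB R c *: f a m + f a n;
  gm_xp : forall a b m, a <= b -> pm_part a m ->
    f b (xp k (b - a) *: m) = xp k (b - a) *: f a m }.

Lemma gradedmap_pmor (e : R) M N (f : pmor M (Defs.shift N e)) :
  @gradedmap e M N (fun _ => pmor_fun f).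
Proof.
split=> [a m /(pmor_part f)//|a c m n _ _|a b m _ _].
  by rewrite linearP.
by rewrite linearZ.
Qed.

Section Extension.
Variables (e : R) (M N : persMod k R) (f : R -> M -> N).
Hypothesis fP : gradedmap e f.

Lemma gm0 a : f a 0 = 0.
Proof.
have := gm_linear fP 1 (pm_part0 M a) (pm_part0 M a).
rewrite constB1 !scale1r addr0 => /eqP.
by rewrite -{1}[f a 0]addr0 (inj_eq (addrI _)) => /eqP.
Qed.

Lemma gmD a m n : pm_part a m -> pm_part a n -> f a (m + n) = f a m + f a n.
Proof.
by move=> am an; have := gm_linear fP 1 am an; rewrite constB1 !scale1r.
Qed.

Lemma gmZ a (c : k) m :
  pm_part a m -> f a (constB R c *: m) = constB R c *: f a m.
Proof.
by move=> am; have := gm_linear fP c am (pm_part0 M a); rewrite gm0 !addr0.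
Qed.

Definition gmext (m : M) : N := \sum_(a <- supp m) f a (hcomp m a).

(** Both lists can be enlarged to a common one because [f a 0 = 0]. Hence the extension may be
    computed from any convenient decomposition. *)
Lemma gmextE m s c : decomposes m s c -> gmext m = \sum_(a <- s) f a (c a).
Proof.
move=> dc; have cE := hcompE dc; have [us _ c0 _] := dc.
have [us' _ c0' _] := decomposes_comp m.
pose u := undup (s ++ supp m).
have uu : uniq u := undup_uniq _.
rewrite /gmext -(big_uniq_support us' uu); last 2 first.
- by move=> b bs; rewrite mem_undup mem_cat bs orbT.
- by move=> b bs; rewrite c0' // gm0.
rewrite -(big_uniq_support us uu).
- by apply: eq_bigr => a _; rewrite cE.
- by move=> b bs; rewrite mem_undup mem_cat bs.
- by move=> b bs; rewrite c0 // gm0.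
Qed.

Lemma gmext_hom a m : pm_part a m -> gmext m = f a m.
Proof.
by move=> /decomposes_hom/gmextE ->; rewrite big_seq1 eqxx.
Qed.

Lemma gmextD m n : gmext (m + n) = gmext m + gmext n.
Proof.
have [s [dm dn]] := decomposes_common m n.
rewrite (gmextE (decomposesD dm dn)) (gmextE dm) (gmextE dn) -big_split /=.
by apply: eq_bigr => a _; rewrite gmD //; apply: hcomp_part.
Qed.

(** Every scalar is a sum of monomials [c x^r], and multiplying by such a monomial only shifts the
    list of degrees by [r]. *)
Lemma gmext_linear : linear gmext.
Proof.
move=> p m n; rewrite gmextD; congr (_ + _).
elim/B1_ind: p => [|p q IHp IHq|c r r0].
- by rewrite !scale0r (gmext_hom (pm_part0 M 0)) gm0.
- by rewrite !scalerDl gmextD IHp IHq.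
- have dm := decomposes_comp m.
  rewrite (gmextE (decomposesZ c r0 dm)) (gmextE dm) big_map scaler_sumr.
  apply: eq_bigr => a _; rewrite addrK -!scalerA gmZ.
    have := @gm_xp _ _ _ _ fP a (a + r) (hcomp m a).
    rewrite addrAC subrr add0r => -> //; first by rewrite lerDl.
    exact: hcomp_part.
  have := @pm_part_xp _ _ M a (a + r) (hcomp m a).
  by rewrite addrAC subrr add0r; apply; rewrite ?lerDl //; apply: hcomp_part.
Qed.

Lemma gmext_sum (s : seq R) (c : R -> M) :
  gmext (\sum_(a <- s) c a) = \sum_(a <- s) gmext (c a).
Proof.
by apply: (big_morph gmext gmextD); rewrite (gmext_hom (pm_part0 M 0)) gm0.
Qed.

HB.instance Definition _ := GRing.isLinear.Build _ M N _ gmext gmext_linear.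

Lemma gmext_part a m : pm_part a m -> pm_part a (gmext m : Defs.shift N e).
Proof. by move=> am; rewrite (gmext_hom am); apply: (gm_part fP). Qed.

Definition gmext_pmor : pmor M (Defs.shift N e) :=
  @PMor k R M (Defs.shift N e) (gmext : {linear M -> N}) gmext_part.

End Extension.

Lemma interleaved_gradedmaps (eps : {nonneg R}) M N
    (f : R -> M -> N) (g : R -> N -> M) :
  gradedmap eps%:num f -> gradedmap eps%:num g ->
  (forall a m, pm_part a m ->
     g (a + eps%:num) (f a m) = xp k (eps%:num + eps%:num) *: m) ->
  (forall a n, pm_part a n ->
     f (a + eps%:num) (g a n) = xp k (eps%:num + eps%:num) *: n) ->
  interleaved eps M N.
Proof.
move=> fP gP gf fg; exists (gmext_pmor fP), (gmext_pmor gP).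
have aux (P Q : persMod k R) (f1 : R -> P -> Q) (g1 : R -> Q -> P)
    (f1P : gradedmap eps%:num f1) (g1P : gradedmap eps%:num g1) :
    (forall a m, pm_part a m ->
       g1 (a + eps%:num) (f1 a m) = xp k (eps%:num + eps%:num) *: m) ->
    forall m, gmext g1 (gmext f1 m) = xp k (eps%:num + eps%:num) *: m.
  move=> gf1 m; have := decomposes_comp m.
  move: (supp m) (hcomp m) => s c [_ hc _ ->].
  rewrite (gmext_sum f1P) (gmext_sum g1P) scaler_sumr; apply: eq_bigr => a _.
  by rewrite (gmext_hom f1P (hc a)) (gmext_hom g1P (gm_part f1P (hc a))) gf1.
by split=> m /=; rewrite xpowE; apply: aux.
Qed.

End GradedMaps.

(** * Interleavings of modules with finitely many critical values *)

Section Closure.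
Variables (k : fieldType) (R : realType).
Implicit Types M N : persMod k R.

Lemma scale_xpD M (r s : R) (m : M) : 0 <= r -> 0 <= s ->
  xp k r *: (xp k s *: m) = xp k (r + s) *: m.
Proof. by move=> r0 s0; rewrite scalerA (xpD k r0 s0). Qed.

Lemma scale_xp_eq M (r s : R) (m : M) : r = s -> xp k r *: m = xp k s *: m.
Proof. by move=> ->. Qed.

(** Values may be chosen independently of each other: linearity and compatibility with transition
    maps follow from uniqueness, as both sides of each identity are related to the same element. *)
Lemma gradedmap_relation (e : R) M N (H : R -> M -> N -> Prop) :
  (forall a m, pm_part a m -> exists2 n, pm_part (a + e) n & H a m n) ->
  (forall a m n n', pm_part a m -> H a m n -> H a m n' -> n = n') ->
  (forall a c m m' n n', H a m n -> H a m' n' ->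
     H a (constB R c *: m + m') (constB R c *: n + n')) ->
  (forall a b m n, a <= b -> H a m n ->
     H b (xp k (b - a) *: m) (xp k (b - a) *: n)) ->
  exists2 f, gradedmap e f & forall a m, pm_part a m -> H a m (f a m).
Proof.
move=> Hex Huniq Hlin Hxp.
have /choice[f fP] : forall am : R * M, exists n,
    pm_part am.1 am.2 -> pm_part (am.1 + e) n /\ H am.1 am.2 n.
  move=> [a m] /=; have [am|nam] := pselect (pm_part a m).
    by have [n an Hn] := Hex a m am; exists n.
  by exists 0 => /nam.
exists (fun a m => f (a, m)) => [|a m am]; last by have [] := fP (a, m) am.
split=> [a m am|a c m n am an|a b m ab am].
- by have [] := fP (a, m) am.
- have amn : pm_part a (constB R c *: m + n).
    by apply: pm_partD => //; apply: pm_partZ.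
  apply: (Huniq _ _ _ _ amn); first by have [] := fP (a, _) amn.
  by apply: Hlin; [have [] := fP (a, m) am|have [] := fP (a, n) an].
- have bm := pm_part_xp ab am.
  apply: (Huniq _ _ _ _ bm); first by have [] := fP (b, _) bm.
  by apply: Hxp => //; have [] := fP (a, m) am.
Qed.

(** Bijectivity of the transition map from degree [a] to degree [b]. *)
Definition constant_between M (a b : R) : Prop :=
  (forall m : M, pm_part a m -> xp k (b - a) *: m = 0 -> m = 0) /\
  (forall n : M, pm_part b n ->
    exists2 m : M, pm_part a m & n = xp k (b - a) *: m).

(** The interval is open at [a] and closed at [b] because a generator or relation of grade [u]
    already takes effect in degree [u]. *)
Definition free_of (U : seq R) (a b : R) : Prop :=
  forall u, u \in U -> a < u -> u <= b -> False.

Definition critical_values M (U : seq R) : Prop :=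
  forall a b, a <= b -> free_of U a b -> constant_between M a b.

Lemma constant_between_inj M a b (m n : M) : constant_between M a b ->
  pm_part a m -> pm_part a n -> xp k (b - a) *: m = xp k (b - a) *: n -> m = n.
Proof.
move=> [inj _] am an mn; apply/eqP; rewrite -subr_eq0; apply/eqP.
by apply: inj; [apply: pm_partB|rewrite scalerBr mn subrr].
Qed.

(** * Descending a map of degree [e + d] to degree [e] *)

Section Descent.
Variables (e d : R) (U : seq R) (fl : R -> R).
Hypotheses (e0 : 0 <= e) (d0 : 0 <= d).
Hypothesis fl_le : forall a, fl a <= a.
Hypothesis fl_mono : forall a b, a <= b -> fl a <= fl b.
Hypothesis fl_free : forall a, free_of U (fl a) a.
Hypothesis fl_free1 : forall a, free_of U (fl a + e) (fl a + e + d).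
Hypothesis fl_free2 :
  forall a, free_of U (fl a + e + e) (fl a + e + e + (d + d)).

(** The descended map moves [m] back to degree [fl a], applies [f], divides the result by [x^d] to
    reach degree [fl a + e], and pushes forward to degree [a + e]. *)
Definition descent M N (f : R -> M -> N) (a : R) (m : M) (n : N) : Prop :=
  exists m' n', [/\ pm_part (fl a) m', pm_part (fl a + e) n',
    m = xp k (a - fl a) *: m', n = xp k (a - fl a) *: n' &
    xp k d *: n' = f (fl a) m'].

(** The transition maps of [M] from [fl a] to [a] and of [N] from [fl a + e] to [fl a + e + d] are
    bijective. Surjectivity gives a value and injectivity makes it unique. *)
Lemma descent_exists M N (f : R -> M -> N) :
  critical_values M U -> critical_values N U -> gradedmap (e + d) f ->
  exists2 f', gradedmap e f' &
    forall a m, pm_part a m -> descent f a m (f' a m).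
Proof.
move=> UM UN fP; apply: gradedmap_relation.
- move=> a m am.
  have [_ /(_ m am)[m' am' mE]] := UM _ _ (fl_le a) (@fl_free a).
  have ed : fl a + e <= fl a + e + d by rewrite lerDl.
  have [_ /(_ (f (fl a) m'))[]] := UN _ _ ed (@fl_free1 a).
    by rewrite -addrA; apply: (gm_part fP).
  move=> n' an' fE; exists (xp k (a - fl a) *: n').
    have -> : a - fl a = a + e - (fl a + e) by ring.
    by apply: pm_part_xp => //; rewrite lerD2r.
  by exists m', n'; split=> //; rewrite fE; apply: scale_xp_eq; ring.
- move=> a m n1 n2 am [m1 [n1' [am1 an1 -> -> E1]]].
  move=> [m2 [n2' [am2 an2 mE -> E2]]].
  have m12 :=
    constant_between_inj (UM _ _ (fl_le a) (@fl_free a)) am1 am2 mE.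
  congr (_ *: _).
  have ed : fl a + e <= fl a + e + d by rewrite lerDl.
  apply: (constant_between_inj (UN _ _ ed (@fl_free1 a))) => //.
  have -> : fl a + e + d - (fl a + e) = d by ring.
  by rewrite E1 E2 m12.
- move=> a c m1 m2 n1 n2 [m1' [n1' [am1 an1 -> -> E1]]].
  move=> [m2' [n2' [am2 an2 -> -> E2]]].
  exists (constB R c *: m1' + m2'), (constB R c *: n1' + n2'); split.
  + by apply: pm_partD => //; apply: pm_partZ.
  + by apply: pm_partD => //; apply: pm_partZ.
  + by rewrite scalerDr !scalerA [xp _ _ * _]mulrC.
  + by rewrite scalerDr !scalerA [xp _ _ * _]mulrC.
  + by rewrite (gm_linear fP) // -E1 -E2 scalerDr !scalerA [xp _ _ * _]mulrC.
- move=> a b m n ab [m' [n' [am an -> -> E]]].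
  have flab := fl_mono ab.
  exists (xp k (fl b - fl a) *: m'), (xp k (fl b - fl a) *: n'); split.
  + exact: pm_part_xp.
  + have -> : fl b - fl a = fl b + e - (fl a + e) by ring.
    by apply: pm_part_xp => //; rewrite lerD2r.
  + by rewrite !scale_xpD ?subr_ge0 //; apply: scale_xp_eq; ring.
  + by rewrite !scale_xpD ?subr_ge0 //; apply: scale_xp_eq; ring.
  + by rewrite (gm_xp fP) // -E !scalerA mulrC.
Qed.

(** By naturality it is enough to treat [n'] in degree [b = fl a + e]. There the identity can be
    tested after multiplication by [x^(d + d)], which is injective by [fl_free2]; one factor [x^d]
    turns [g'] into [g], the other turns [f'] into [f], and the hypothesis on [f] and [g]
    applies. *)
Lemma descent_comp M N (f f' : R -> M -> N) (g g' : R -> N -> M) :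
  critical_values M U -> gradedmap (e + d) f -> gradedmap (e + d) g ->
  gradedmap e f' -> gradedmap e g' ->
  (forall a m, pm_part a m -> descent f a m (f' a m)) ->
  (forall a n, pm_part a n -> descent g a n (g' a n)) ->
  (forall a m, pm_part a m ->
     g (a + (e + d)) (f a m) = xp k (e + d + (e + d)) *: m) ->
  forall a m, pm_part a m -> g' (a + e) (f' a m) = xp k (e + e) *: m.
Proof.
move=> UM fP gP f'P g'P f'f g'g gf a m am.
have [m' [n' [am' an' mE nE fE]]] := f'f a m am.
have aE : a - fl a = a + e - (fl a + e) by ring.
have ale : fl a + e <= a + e by rewrite lerD2r.
rewrite nE mE aE (gm_xp g'P ale an') [RHS]scalerA mulrC -[RHS]scalerA.
congr (_ *: _).
set b := fl a + e in an' *.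
have [n1 [p1 [bn1 bp1 n'E pE gE]]] := g'g b n' an'.
have flb := fl_le b.
have b2 : b + e <= b + e + (d + d) by rewrite lerDl addr_ge0.
apply: (constant_between_inj (UM _ _ b2 (@fl_free2 a))).
- exact: (gm_part g'P).
- have -> : e + e = b + e - fl a by rewrite /b; ring.
  by apply: pm_part_xp => //; rewrite /b -addrA lerDl addr_ge0.
have -> : b + e + (d + d) - (b + e) = d + d by ring.
rewrite pE -scale_xpD //.
have -> : xp k d *: (xp k (b - fl b) *: p1) = xp k (b - fl b) *: g (fl b) n1.
  by rewrite -gE !scalerA mulrC.
rewrite !scale_xpD ?subr_ge0 ?addr_ge0 //.
have -> : d + (b - fl b) = b + d - fl b by ring.
rewrite -(gm_xp gP) //; last by rewrite (le_trans flb) ?lerDl.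
have -> : b + d - fl b = d + (b - fl b) by ring.
rewrite -scale_xpD ?subr_ge0 // -n'E fE.
have -> : b + d = fl a + (e + d) by rewrite /b; ring.
by rewrite gf //; apply: scale_xp_eq; ring.
Qed.

End Descent.

(** [fl a] is the maximum of [Num.min a L] and the elements of [U] that are at most [a]; the first
    term is the fallback when there are no such elements. *)
Lemma floor_exists (U : seq R) (L : R) : exists fl : R -> R,
  [/\ forall a, fl a <= a, forall a b, a <= b -> fl a <= fl b,
      forall a u, u \in U -> u <= a -> u <= fl a &
      forall a, fl a \in U \/ fl a <= L].
Proof.
elim: U => [|u U [fl [le mono ge mem]]].
  exists (Num.min ^~ L); split=> // [a|a b ab|a].
  - by rewrite ge_min lexx.
  - by rewrite le_min !ge_min ab lexx orbT.
  - by right; rewrite ge_min lexx orbT.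
exists (fun a => if u <= a then Num.max u (fl a) else fl a); split.
- by move=> a; case: ifP => // ua; rewrite ge_max ua le.
- move=> a b ab; case: ifP => [ua|_]; last first.
    by case: ifP => _; rewrite ?le_max mono ?orbT.
  by rewrite (le_trans ua ab) ge_max !le_max lexx mono ?orbT.
- move=> a v; rewrite inE => /predU1P[->|vU] va.
    by rewrite va le_max lexx.
  by case: ifP => _; rewrite ?le_max ge ?orbT.
- move=> a; case: ifP => _; last first.
    by case: (mem a) => h; [left; rewrite inE h orbT|right].
  rewrite /Num.max; case: ifP => _; last by left; rewrite mem_head.
  by case: (mem a) => h; [left; rewrite inE h orbT|right].
Qed.

Lemma positive_lower_bound (s : seq R) :
  exists2 d, 0 < d & forall x, x \in s -> 0 < x -> d < x.
Proof.
elim: s => [|x s [d d0 hd]]; first by exists 1.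
have [x0|x0] := ltP 0 x; last first.
  exists d => // y; rewrite inE => /predU1P[->|/hd//].
  by rewrite ltNge x0.
exists (Num.min d x / 2); first by rewrite divr_gt0 // lt_min d0.
have m0 : 0 < Num.min d x by rewrite lt_min d0.
have m2 : Num.min d x / 2 < Num.min d x by rewrite gtr_pMr // invf_lt1 // ltr1n.
move=> y; rewrite inE => /predU1P[->|ys] y0.
  by rewrite (lt_le_trans m2) // ge_min lexx orbT.
by rewrite (lt_trans (lt_le_trans m2 _) (hd _ ys y0)) // ge_min lexx.
Qed.

Lemma strict_lower_bound (s : seq R) : exists L, forall x, x \in s -> L < x.
Proof.
elim: s => [|x s [L hL]]; first by exists 0.
exists (Num.min L (x - 1)) => y; rewrite inE gt_min => /predU1P[->|/hL ->//].
by rewrite gtrBl ltr01 orbT.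
Qed.

Lemma critical_values_cat M (U V : seq R) :
  critical_values M U \/ critical_values M V -> critical_values M (U ++ V).
Proof.
move=> UV a b ab UVab; case: UV; apply=> // u uUV;
  by apply: UVab; rewrite mem_cat uUV ?orbT.
Qed.

(* For small [d], the interval from [u + e] to [u + e + d] contains no critical
   value when [u] is critical, so maps into degree [u + e + d] lift to degree
   [u + e]; they then extend to all degrees by constancy between critical
   values. *)
Lemma interleaved_closure (eps : {nonneg R}) M N U V :
  critical_values M U -> critical_values N V ->
  (forall d : {posnum R}, interleaved (eps%:num + d%:num)%:nng M N) ->
  interleaved eps M N.
Proof.
move=> UM VN I; pose W := U ++ V; pose e : R := eps%:num.
have e0 : (0 : R) <= e by rewrite /e.
have WM : critical_values M W by apply: critical_values_cat; left.
have WN : critical_values N W by apply: critical_values_cat; right.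
(* Staying below every positive [v - u - e] keeps critical values [v] out of the interval from
   [u + e] to [u + e + d]; the halved gaps do the same for [u + e + e] and [d + d]. *)
have [d d0 hd] := positive_lower_bound (1 :: [seq v - u - e | v <- W, u <- W]
  ++ [seq (v - u - e - e) / 2 | v <- W, u <- W]).
have d1 : d < 1 by apply: hd; rewrite ?mem_head.
(* As [d < 1], shifting a degree that is at most [L] by [e + e + (d + d)] still leaves it below all
   critical values, which settles the fallback case of [fl]. *)
have [L hL] := strict_lower_bound [seq v - (e + e + 2) | v <- W].
have [fl [fl_le fl_mono fl_ge fl_mem]] := floor_exists W L.
have LW v : v \in W -> L + (e + e + 2) < v.
  by move=> vW; rewrite -ltrBrDr hL //; apply: (map_f (fun v => v - _)).
have free0 a : free_of W (fl a) a.
  by move=> u uW lt_u le_u; have := fl_ge a u uW le_u; rewrite leNgt lt_u.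
have free1 a : free_of W (fl a + e) (fl a + e + d).
  move=> v vW lt_v le_v; case: (fl_mem a) => [uW|flL].
    suff dlt : d < v - fl a - e by lra.
    apply: hd; last by lra.
    rewrite inE mem_cat; apply/orP; right; apply/orP; left.
    by apply/allpairsP; exists (v, fl a).
  by have LWv := LW v vW; lra.
have free2 a : free_of W (fl a + e + e) (fl a + e + e + (d + d)).
  move=> v vW lt_v le_v; case: (fl_mem a) => [uW|flL].
    suff dlt : d < (v - fl a - e - e) / 2 by lra.
    apply: hd; last by lra.
    rewrite inE mem_cat; apply/orP; right; apply/orP; right.
    by apply/allpairsP; exists (v, fl a).
  by have LWv := LW v vW; lra.
have [f [g [gf fg]]] := I (PosNum d0).
have fP := gradedmap_pmor f; have gP := gradedmap_pmor g.
have [f' f'P f'f] :=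
  descent_exists (ltW d0) fl_le fl_mono free0 free1 WM WN fP.
have [g' g'P g'g] :=
  descent_exists (ltW d0) fl_le fl_mono free0 free1 WN WM gP.
apply: (interleaved_gradedmaps f'P g'P).
- apply: (descent_comp e0 (ltW d0) fl_le free2 WM fP gP f'P g'P f'f g'g).
  by move=> a m _; have := gf m; rewrite /= xpowE.
- apply: (descent_comp e0 (ltW d0) fl_le free2 WN gP fP g'P f'P g'g f'f).
  by move=> a n _; have := fg n; rewrite /= xpowE.
Qed.

End Closure.

(** * Critical values of finitely presented modules *)

Section FinitePresentation.
Variables (k : fieldType) (R : realType).
Implicit Types M N : persMod k R.

Lemma constB0 : constB R (0 : k) = 0.
Proof. exact: monalg.monalgU0. Qed.

Lemma hcomp0 M a : hcomp (0 : M) a = 0.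
Proof. by rewrite (hcomp_hom _ (pm_part0 M a)); case: ifP. Qed.

Lemma hcomp_pmor M N (p : pmor M N) (m : M) a : hcomp (p m) a = p (hcomp m a).
Proof.
have [us hc c0 mE] := decomposes_comp m.
have dp : decomposes (p m) (supp m) (fun b => p (hcomp m b)).
  split=> // [b|b /c0 ->|]; first exact/pmor_part/hc; first exact: raddf0.
  by rewrite [in LHS]mE raddf_sum.
exact: (hcompE dp).
Qed.

Lemma homogeneous_preimage M N (p : pmor M N) (n : N) a :
  (forall n, exists m, p m = n) -> pm_part a n ->
  exists2 m, pm_part a m & p m = n.
Proof.
move=> psurj an; have [m mn] := psurj n.
exists (hcomp m a); first exact: hcomp_part.
by rewrite -hcomp_pmor mn (hcomp_hom a an) eqxx.
Qed.

(** When [d <= b], the witness is the coefficient of [x^(b - d)] in [p]. *)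
Lemma hcomp_multiple M (p : B1 k R) d (r : M) b : pm_part d r -> exists c : k,
  hcomp (p *: r) b = if d <= b then (constB R c * xp k (b - d)) *: r else 0.
Proof.
move=> dr; elim/B1_ind: p => [|p q [c pE] [c' qE]|c s s0].
- by exists 0; rewrite scale0r hcomp0 constB0 mul0r scale0r; case: ifP.
- exists (c + c'); rewrite scalerDl hcompD pE qE constBD mulrDl.
  by case: (d <= b); [rewrite scalerDl|rewrite addr0].
- have ds : d <= d + s by rewrite lerDl.
  have := pm_partZ c (pm_part_xp ds dr).
  rewrite addrAC subrr add0r scalerA => h.
  rewrite (hcomp_hom _ h); exists (if b == d + s then c else 0).
  case: eqP => [->|_]; first by rewrite ds addrAC subrr add0r.
  by rewrite constB0 mul0r scale0r; case: ifP.
Qed.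

(** Only the terms of degree [b] matter, and they involve only those [r i] with [d i <= b]. By
    hypothesis these have [d i <= a], so their coefficients, multiples of [x^(b - d i)], are
    divisible by [x^(b - a)]. *)
Lemma homogeneous_combination M n (r : 'I_n -> M) (d : 'I_n -> R) a b w :
  (forall i, pm_part (d i) (r i)) -> a <= b ->
  (forall i, a < d i -> d i <= b -> False) ->
  pm_part b w -> submod_gen r w ->
  exists2 w', submod_gen r w' & w = xp k (b - a) *: w'.
Proof.
move=> dr ab free bw [p wE].
have /choice[c cE] i := @hcomp_multiple M (p i) _ _ b (dr i).
exists (\sum_i
  (if d i <= a then constB R (c i) * xp k (a - d i) else 0) *: r i).
  by eexists.
have compS : {morph (fun m : M => hcomp m b) : m n / m + n}.
  by move=> x y; apply: hcompD.
have -> : w = hcomp w b by rewrite (hcomp_hom b bw) eqxx.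
rewrite wE (big_morph _ compS (hcomp0 M b)) scaler_sumr; apply: eq_bigr => i _.
rewrite cE; case: (leP (d i) a) => da.
  have a0 : 0 <= a - d i by rewrite subr_ge0.
  have b0 : 0 <= b - a by rewrite subr_ge0.
  by rewrite (le_trans da ab) scalerA mulrCA -(xpD k b0 a0) addrA subrK.
rewrite scale0r scaler0; case: ifP => // db; by case: (free i da db).
Qed.

Lemma coefB_mono (c : k) (s : R) (al : expo R) : 0 <= s ->
  Defs.coefB al (constB R c * xp k s) = c *+ (s == al%:num).
Proof.
move=> s0; have -> : s = (NngNum s0)%:num by [].
by rewrite -xpowE -constB_xpow /Defs.coefB monalg.mcoeffU; congr (_ *+ _).
Qed.

Lemma coefB_xp (r : R) (al be : expo R) (p : B1 k R) :
  0 <= r -> be%:num = r + al%:num ->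
  Defs.coefB be (xp k r * p) = Defs.coefB al p.
Proof.
move=> r0 beE; elim/B1_ind: p => [|p q pE qE|c s s0].
- by rewrite mulr0 /Defs.coefB !monalg.mcoeff0.
- rewrite mulrDr /Defs.coefB !monalg.mcoeffD.
  by congr (_ + _); [exact: pE|exact: qE].
- rewrite mulrCA -(xpD k r0 s0) (coefB_mono _ _ s0).
  by rewrite (coefB_mono _ _ (addr_ge0 r0 s0)) beE (inj_eq (addrI r)).
Qed.

Lemma xp_mul_inj (r : R) : 0 <= r -> injective (fun p : B1 k R => xp k r * p).
Proof.
move=> r0 p q pq; apply/monalg.malgP => al.
pose be : expo R := expoD (NngNum r0) al.
have pE := @coefB_xp r al be p r0 erefl.
have qE := @coefB_xp r al be q r0 erefl.
by rewrite -[LHS]pE -[RHS]qE pq.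
Qed.

(** * Division by monomials in free modules *)

Section Free.
Variables (G : finType) (gr : G -> R).

Lemma free_scaleE (p : B1 k R) (v : {ffun G -> (B1 k R)^o}) y :
  (p *: v) y = p * v y.
Proof. by rewrite ffunE. Qed.

Lemma free_xp_inj (r : R) (v w : freeMod k gr) :
  0 <= r -> xp k r *: v = xp k r *: w -> v = w.
Proof.
move=> r0 vw; apply/ffunP => y; apply: (xp_mul_inj r0).
have := congr1 (fun f : {ffun G -> (B1 k R)^o} => f y) vw.
by rewrite [X in X = _]free_scaleE [X in _ = X]free_scaleE.
Qed.

Lemma free_xp_surj a b (v : freeMod k gr) : a <= b ->
  (forall y, a < gr y -> gr y <= b -> False) -> pm_part b v ->
  exists2 w : freeMod k gr, pm_part a w & v = xp k (b - a) *: w.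
Proof.
move=> ab free bv.
(* The [y]-component of [v] can only have a term of exponent [b - gr y]; [c y] is its coefficient,
   and 0 if that exponent is negative. *)
pose c y : k := if pselect (0 <= b - gr y) is left h then
  Defs.coefB (NngNum h) ((v : {ffun G -> (B1 k R)^o}) y) else 0.
exists ([ffun y => if gr y <= a then constB R (c y) * xp k (a - gr y) else 0]).
  move=> y al aly; rewrite ffunE; case: ifP => ya; last first.
    by rewrite /Defs.coefB monalg.mcoeff0.
  by rewrite coefB_mono ?subr_ge0 // eq_sym (negPf aly).
apply/ffunP => y; rewrite [RHS]free_scaleE ffunE; apply/monalg.malgP => al.
case: (leP (gr y) a) => ya.
  have a0 : 0 <= a - gr y by rewrite subr_ge0.
  have ba0 : 0 <= b - a by rewrite subr_ge0.
  have b0 : 0 <= b - gr y by rewrite subr_ge0 (le_trans ya).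
  rewrite -[RHS]/(Defs.coefB al (xp k (b - a) * _)) mulrCA -(xpD k ba0 a0).
  rewrite addrA subrK (coefB_mono _ _ b0).
  case: eqVneq => [bal|bal]; last by rewrite mulr0n; apply: bv; rewrite eq_sym.
  rewrite mulr1n /c; case: pselect => // h; congr (Defs.coefB _ _).
  exact: expo_inj.
rewrite mulr0 [RHS]monalg.mcoeff0; apply: bv; apply/eqP => alE.
apply: (free y ya); rewrite -subr_ge0 -alE.
exact: ge0.
Qed.

End Free.

(** The critical values are the grades of the generators and of the relations. Surjectivity is
    inherited from the free module. For injectivity, a lift [v] with [x^(b - a) v] in the relations
    satisfies [x^(b - a) v = x^(b - a) w] with [w] a combination of relations, and the monomial
    cancels in the free module. *)
Lemma finitely_presented_critical_values M :
  finitely_presented M -> exists U, critical_values M U.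
Proof.
move=> [G [gr [n [r [rhom [p [psurj pker]]]]]]].
have /choice[d dr] := rhom.
exists ([seq gr y | y <- enum G] ++ [seq d i | i <- enum 'I_n]) => a b ab free.
have freeG y : a < gr y -> gr y <= b -> False.
  apply: free; rewrite mem_cat; apply/orP; left.
  by apply: map_f; rewrite mem_enum.
have freeI i : a < d i -> d i <= b -> False.
  apply: free; rewrite mem_cat; apply/orP; right.
  by apply: map_f; rewrite mem_enum.
split=> [m am m0|m bm].
- have [v av vm] := homogeneous_preimage psurj am.
  have /pker pv : p (xp k (b - a) *: v) = 0 by rewrite linearZ vm.
  have [w wr vw] := homogeneous_combination dr ab freeI (pm_part_xp ab av) pv.
  have vw' : v = w by apply: (free_xp_inj _ vw); rewrite subr_ge0.
  by rewrite -vm; apply/pker; rewrite vw'.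
- have [v bv vm] := homogeneous_preimage psurj bm.
  have [w aw vw] := free_xp_surj ab freeG bv.
  by exists (p w); [apply: pmor_part|rewrite -vm vw linearZ].
Qed.

End FinitePresentation.

(** * Matchings of bars *)

Section Matchings.
Variable R : realType.
Implicit Types D : diagram R.

Local Open Scope ereal_scope.

(** The additive form also covers infinite ends: equal infinite ends are near, while a finite and an
    infinite one never are. *)
Definition near_ends (c : R) (p q : \bar R * \bar R) : Prop :=
  [/\ p.1 <= q.1 + c%:E, q.1 <= p.1 + c%:E, p.2 <= q.2 + c%:E &
      q.2 <= p.2 + c%:E].

(* A bar of [D] is a pair [(x, n)] with [n < D x]. *)
Record matching (c : R) D1 D2 (rho : upper R * nat -> upper R * nat -> Prop) :
    Prop := {
  mt_bar : forall u v, rho u v -> (u.2 < D1 u.1)%N /\ (v.2 < D2 v.1)%N;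
  mt_near : forall u v, rho u v -> near_ends c (val u.1) (val v.1);
  mt_fun : forall u v v', rho u v -> rho u v' -> v = v';
  mt_inj : forall u u' v, rho u v -> rho u' v -> u = u';
  mt_shortl : forall u, (u.2 < D1 u.1)%N ->
    (exists v, rho u v) \/ (val u.1).2 <= (val u.1).1 + (c + c)%:E;
  mt_shortr : forall v, (v.2 < D2 v.1)%N ->
    (exists u, rho u v) \/ (val v.1).2 <= (val v.1).1 + (c + c)%:E }.

Lemma matching_sym c D1 D2 rho :
  matching c D1 D2 rho -> matching c D2 D1 (fun u v => rho v u).
Proof.
move=> [b n f i sl sr]; split=> //.
- by move=> u v /b[].
- by move=> u v /n[].
- by move=> u v v'; apply: i.
- by move=> u u' v; apply: f.
Qed.

Lemma lee_trans_addE (x y z : \bar R) (a b : R) :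
  x <= y + a%:E -> y <= z + b%:E -> x <= z + (a + b)%:E.
Proof.
move=> xy yz; apply: (le_trans xy).
by rewrite (addrC a) EFinD addeA; apply: leeD2r.
Qed.

(** If [u] has a partner [v] that is itself unmatched, then [v] has length at most [2c']; the ends
    of [u] are within [c] of those of [v], so [u] has length at most [2(c + c')]. *)
Lemma matching_trans c c' D1 D2 D3 rho sig : (0 <= c)%R -> (0 <= c')%R ->
  matching c D1 D2 rho -> matching c' D2 D3 sig ->
  matching (c + c') D1 D3 (fun u w => exists2 v, rho u v & sig v w).
Proof.
move=> c0 c'0 [b n f i sl sr] [b' n' f' i' sl' sr']; split.
- by move=> u w [v /b[bu _] /b'[_ bw]].
- move=> u w [v /n[n1 n2 n3 n4] /n'[n1' n2' n3' n4']]; split.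
  + exact: lee_trans_addE n1 n1'.
  + by rewrite (addrC c); apply: lee_trans_addE n2' n2.
  + exact: lee_trans_addE n3 n3'.
  + by rewrite (addrC c); apply: lee_trans_addE n4' n4.
- move=> u w w' [v uv vw] [v' uv' vw'].
  by apply: (f' v) => //; rewrite (f u v v').
- move=> u u' w [v uv vw] [v' uv' vw'].
  by apply: (i u u' v) => //; rewrite (i' v v' w).
- move=> u /sl[[v uv]|short]; last first.
    by right; apply: le_trans short _; apply: leeD2l; rewrite lee_fin; lra.
  have [_ /sl'[[w vw]|short]] := b _ _ uv; first by left; exists w, v.
  right; have [_ n2 n3 _] := n _ _ uv.
  have := lee_trans_addE n3 (lee_trans_addE short n2).
  by rewrite (_ : (c + (c' + c' + c) = c + c' + (c + c'))%R) //; ring.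
- move=> w /sr'[[v vw]|short]; last first.
    by right; apply: le_trans short _; apply: leeD2l; rewrite lee_fin; lra.
  have [/sr[[u uv]|short] _] := b' _ _ vw; first by left; exists u, v.
  right; have [n1 _ _ n4] := n' _ _ vw.
  have := lee_trans_addE n4 (lee_trans_addE short n1).
  by rewrite (_ : (c' + (c + c + c') = c + c' + (c + c'))%R) //; ring.
Qed.

Lemma edist_bar_near (c : R) (x y : \bar R) : (0 <= c)%R ->
  edist_bar x y <= c%:E -> x <= y + c%:E /\ y <= x + c%:E.
Proof.
move=> c0; rewrite /edist_bar; case: eqP => [-> _|_].
  by rewrite leeDl.
case: x y => [r||] [s||] //=; rewrite !lee_fin ler_norml => /andP[h1 h2].
by split; rewrite -lerBlDl; lra.
Qed.

Lemma esup0_ub (A : set (\bar R)) (c : \bar R) x : esup0 A < c -> A x -> x <= c.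
Proof.
move=> Ac Ax; apply: le_trans (ltW Ac).
by apply: ereal_sup_ubound; right.
Qed.

Lemma bar_short (c : R) (p : upper R) :
  (2^-1)%:E * ((val p).2 - (val p).1) <= c%:E ->
  (val p).2 <= (val p).1 + (c + c)%:E.
Proof.
case: p => -[[a||] [b||]] //= ab; rewrite ?gt0_muley ?lte_fin ?invr_gt0 //.
rewrite -EFinB -EFinM -EFinD !lee_fin; lra.
Qed.

(* Blocks of lengths [g y], for all [y], tile [0, ..., n - 1]; the block of [y]
   starts at [o y]. *)
Definition layout (T : Type) (n : nat) (g o : T -> nat) : Prop :=
  [/\ forall y l, (l < g y -> o y + l < n)%N,
      forall y y' l l', (l < g y)%N -> (l' < g y')%N ->
        (o y + l = o y' + l')%N -> y = y' /\ l = l' &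
      forall m, (m < n)%N -> exists y l, (l < g y)%N /\ m = (o y + l)%N].

Lemma block_layout (T : eqType) (ys : seq T) (g : T -> nat) : uniq ys ->
  exists o : T -> nat,
  [/\ forall y l, y \in ys -> (l < g y -> o y + l < \sum_(z <- ys) g z)%N,
      forall y y' l l', y \in ys -> y' \in ys -> (l < g y)%N -> (l' < g y')%N ->
        (o y + l = o y' + l')%N -> y = y' /\ l = l' &
      forall m, (m < \sum_(z <- ys) g z)%N ->
        exists y l, [/\ y \in ys, (l < g y)%N & m = (o y + l)%N]].
Proof.
elim: ys => [_|y ys IH /= /andP[yys /IH [off [lt inj surj]]]].
  by exists (fun=> 0%N); split=> // m; rewrite big_nil.
have ne z : z \in ys -> (z == y) = false.
  by move=> zys; apply: contraNF yys => /eqP <-.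
(* The block of [y] is placed after all the others, whose offsets stay unchanged. *)
exists (fun z => if z == y then \sum_(z <- ys) g z else off z)%N; split.
- move=> z l; rewrite inE big_cons; have [->|zy] := eqVneq z y; first by lia.
  by move=> /= zys lz; have := lt z l zys lz; lia.
- move=> z z' l l'; rewrite !inE.
  have [->|zy] := eqVneq z y; have [->|zy'] := eqVneq z' y => //=.
  + by move=> _ _ _ _ /addnI.
  + by move=> _ zys' _ lz'; have := lt z' l' zys' lz'; lia.
  + by move=> zys _ lz _; have := lt z l zys lz; lia.
  + exact: inj.
- move=> m; rewrite big_cons => lt_m.
  have [/surj[z [l [zys lz ->]]]|le_m] := ltnP m (\sum_(z <- ys) g z).
    by exists z, l; rewrite inE zys orbT ne.
  exists y, (m - \sum_(z <- ys) g z)%N; rewrite mem_head eqxx.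
  by split => //; lia.
Qed.

(** This turns one row or column of a multibijection into a tiling by blocks. A multibijection gives
    finiteness and the sum only on the support, hence the separate case [n = 0], where all blocks
    are empty. *)
Lemma layout_exists D (g : upper R -> nat) (n : nat) :
  (forall y, g y != 0%N -> dsupp D y) -> (forall y, g y != 0%N -> n != 0%N) ->
  (n != 0%N -> finite_set [set y | g y != 0%N]) ->
  (n != 0%N -> n = (\sum_(y \in dsupp D) g y)%R) ->
  exists o : upper R -> nat, layout n g o.
Proof.
move=> gD gn gfin gsum; have [n0|n0] := eqVneq n 0%N.
  have g0 y l : (l < g y)%N -> False.
    by move=> ly; have /gn : g y != 0%N; rewrite ?n0 // -lt0n; lia.
  by exists (fun=> 0%N); split=> [y l /g0|y y' l l' /g0|m]; rewrite ?n0.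
pose ys := finite_support 0%N (dsupp D) g.
have -> : n = (\sum_(y <- ys) g y)%N by apply: gsum.
have ysE y l : (l < g y)%N -> y \in ys.
  move=> ly; have gy : g y != 0%N by rewrite -lt0n; lia.
  rewrite in_finite_support.
    by rewrite inE; split; [exact: gD|exact/eqP].
  by apply: sub_finite_set (gfin n0) => z [_] /eqP.
have [off [lt inj surj]] :=
  block_layout g (finite_support_uniq 0%N (dsupp D) g).
exists off; split=> [y l ly|y y' l l' ly ly'|m /surj[y [l [_ ly ->]]]].
- exact: lt (ysE _ _ ly) ly.
- by apply: inj => //; [exact: ysE ly|exact: ysE ly'].
- by exists y, l.
Qed.

(** A strict bound on the infimum yields a multibijection of cost below [c]. A copy of [x] of index
    at least [D1' x] places [x] in the support of [D1 - D1'], so the cost bounds its length. *)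
Lemma bottleneck_matching D1 D2 (c : R) : (0 <= c)%R ->
  bottleneck D1 D2 < c%:E -> exists rho, matching c D1 D2 rho.
Proof.
move=> c0 /ereal_inf_lt[_ [D1' [D2' [gam [D1'le D2'le mb ->]]]]].
rewrite /matching_cost gt_max => /andP[short near].
have [mbs mbfl mbsl mbfr mbsr] := mb.
have /choice[pos1 pos1P] : forall x, exists o, layout (D1' x) (gam x) o.
  move=> x; apply: (@layout_exists D2') => [y /mbs[]|y /mbs[]||] //.
    exact: mbfl.
  exact: mbsl.
have /choice[pos2 pos2P] : forall y, exists o, layout (D2' y) (gam ^~ y) o.
  move=> y; apply: (@layout_exists D1') => [x /mbs[]|x /mbs[]||] //.
    exact: mbfr.
  exact: mbsr.
(* The copies of [x] and those of [y] each contain a block of length [gam x y]; the [l]-th elements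
   of these two blocks are paired. *)
exists (fun u v => exists l, [/\ (l < gam u.1 v.1)%N,
  u.2 = (pos1 u.1 v.1 + l)%N & v.2 = (pos2 v.1 u.1 + l)%N]); split.
- move=> u v [l [lg -> ->]].
  have [lt1 _ _] := pos1P u.1; have [lt2 _ _] := pos2P v.1.
  split; first by apply: leq_trans (D1'le _); apply: lt1.
  by apply: leq_trans (D2'le _); apply: lt2.
- move=> u v [l [lg _ _]].
  have : linf (val u.1) (val v.1) <= c%:E.
    apply: (esup0_ub near); exists (u.1, v.1) => //=.
    by rewrite -lt0n; lia.
  rewrite /linf ge_max => /andP[].
  move=> /(edist_bar_near c0)[n1 n2] /(edist_bar_near c0)[n3 n4].
  by split.
- move=> [x m] [y n] [y' n'] /= [l [lg -> ->]] [l' [lg' mE ->]].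
  by have [_ inj _] := pos1P x; have [<- <-] := inj _ _ _ _ lg lg' mE.
- move=> [x m] [x' m'] [y n] /= [l [lg -> ->]] [l' [lg' -> nE]].
  by have [_ inj _] := pos2P y; have [<- <-] := inj _ _ _ _ lg lg' nE.
- move=> [x m] /= mD; have [mD'|mD'] := ltnP m (D1' x).
    have [_ _ /(_ m mD')[y [l [lg mE]]]] := pos1P x.
    by left; exists (y, pos2 y x + l)%N, l.
  right; apply: bar_short; apply: (esup0_ub short); exists x => //.
  by left; rewrite /dsupp /= -lt0n; lia.
- move=> [y n] /= nD; have [nD'|nD'] := ltnP n (D2' y).
    have [_ _ /(_ n nD')[x [l [lg nE]]]] := pos2P y.
    by left; exists (x, pos1 x y + l)%N, l.
  right; apply: bar_short; apply: (esup0_ub short); exists y => //.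
  by right; rewrite /dsupp /= -lt0n; lia.
Qed.

End Matchings.

(** * Interleaving discretizations *)

Section BarMaps.
Variables (k : fieldType) (D1 D2 : diagram int).

(** This is [y <= x + s] tested on integers, so that infinite ends need no arithmetic. *)
Definition before (x y : \bar int) (s : int) : Prop :=
  forall z : int, (x <= z%:E)%E -> (y <= (z + s)%:E)%E.

Record near_bars (s : int) (i : bar_index D1) (j : bar_index D2) : Prop := {
  nb_birth : before (val (tag i)).1 (val (tag j)).1 s;
  nb_birth' : before (val (tag j)).1 (val (tag i)).1 s;
  nb_death : before (val (tag i)).2 (val (tag j)).2 s;
  nb_death' : before (val (tag j)).2 (val (tag i)).2 s }.

(** Each bar is sent to its partner, then truncated to the bars alive in degree [z + s]. The partner
    map [pr] goes backwards so that coefficients are simply pulled back. *)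
Definition barmap (s : int) (pr : bar_index D2 -> option (bar_index D1))
    (z : int) (v : bar_index D1 -> k) : bar_index D2 -> k :=
  fun j => if alive j (z + s) then if pr j is Some i then v i else 0 else 0.

Variables (s : int) (pr : bar_index D2 -> option (bar_index D1)).
Hypothesis pr_inj : forall i j j', pr j = Some i -> pr j' = Some i -> j = j'.
Hypothesis pr_near : forall i j, pr j = Some i -> near_bars s i j.

(** Injectivity of [pr] keeps supports finite. *)
Lemma barmap_part z v : isum_part z v -> isum_part (z + s) (barmap s pr z v).
Proof.
move=> [vfin v0]; split; last by move=> j jz; rewrite /barmap (negPf jz).
have sub : [set j | barmap s pr z v j != 0] `<=`
    [set j | pr j != None] `&` pr @^-1` (Some @` [set i | v i != 0]).
  move=> j /=; rewrite /barmap; case: ifP => _; last by rewrite eqxx.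
  by case: (pr j) => [i vi|]; [split=> //; exists i|rewrite eqxx].
apply: (sub_finite_set sub).
have -> : [set j | pr j != None] `&` pr @^-1` (Some @` [set i | v i != 0])
    = pr @^-1` (Some @` [set i | v i != 0]).
  by apply/seteqP; split=> j /= [] // i vi <-; split=> //; exists i.
apply: finite_preimage; last exact: finite_image.
move=> j j'; rewrite !inE => -[i _ ji] [i' _ j'i'] jj'.
by apply: (pr_inj (i := i)); rewrite ?ji // -jj' -ji.
Qed.

Lemma barmap_linear z (c : k) v w :
  barmap s pr z (fun i => c * v i + w i)
  = (fun j => c * barmap s pr z v j + barmap s pr z w j).
Proof.
apply/funext => j; rewrite /barmap.
by case: ifP => _; [case: (pr j) => [//|]|]; rewrite mulr0 addr0.
Qed.

(** The truncations agree where [v i] is nonzero: [i] is born by [y], so [j] is born by [y + s], and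
    if [j] survives at [z + s] then [i] survives at [z]. *)
Lemma barmap_trans y z v : y <= z -> isum_part y v ->
  barmap s pr z (isum_trans z v) = isum_trans (z + s) (barmap s pr y v).
Proof.
move=> yz [_ v0]; apply/funext => j; rewrite /barmap /isum_trans.
case: ifP => // /andP[_ zj2]; case prj: (pr j) => [i|]; last by case: ifP.
have [vi|vi] := eqVneq (v i) 0; first by rewrite vi !if_same.
have /andP[i1y yi2] : alive i y by apply: contraNT vi => /v0 ->.
have [near1 _ near2 _] := pr_near prj.
have -> : alive j (y + s).
  rewrite /alive near1 //=; apply: le_lt_trans zj2.
  by rewrite lee_fin lerD2r.
have -> // : alive i z.
rewrite /alive (le_trans i1y) ?lee_fin //= ltNge; apply/negP => /near2.
by rewrite leNgt zj2.
Qed.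

End BarMaps.

(** An unmatched bar alive at [z] is dead by [z + s + s], so losing it is harmless. If a matched bar
    lives from [z] to [z + s + s], its partner is alive at [z + s] and the coefficient survives the
    round trip. *)
Lemma barmap_comp (k : fieldType) (D1 D2 : diagram int) (s : int)
    (pr : bar_index D2 -> option (bar_index D1))
    (pl : bar_index D1 -> option (bar_index D2)) (z : int)
    (v : bar_index D1 -> k) :
  0 <= s ->
  (forall i j, pl i = Some j -> pr j = Some i) ->
  (forall i j, pr j = Some i -> near_bars s i j) ->
  (forall i, pl i = None -> before (val (tag i)).1 (val (tag i)).2 (s + s)) ->
  isum_part z v ->
  barmap s pl (z + s) (barmap s pr z v) = isum_trans (z + s + s) v.
Proof.
move=> s0 plr near short [_ v0]; apply/funext => i; rewrite /barmap /isum_trans.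
case: ifP => // /andP[_ zi2].
have [vi|vi] := eqVneq (v i) 0.
  case pli: (pl i) => [j|]; rewrite vi // (plr _ _ pli) vi.
  by case: ifP.
have /andP[i1z zi2'] : alive i z by apply: contraNT vi => /v0 ->.
case pli: (pl i) => [j|]; last first.
  by have := short i pli z i1z; rewrite addrA leNgt zi2.
have prj := plr _ _ pli; have [near1 _ _ near2] := near _ _ prj.
rewrite prj; have -> // : alive j (z + s).
by rewrite /alive near1 //= ltNge; apply/negP => /near2; rewrite leNgt zi2.
Qed.

Lemma near_bars_sym (D1 D2 : diagram int) s
    (i : bar_index D1) (j : bar_index D2) :
  near_bars s i j -> near_bars s j i.
Proof. by case. Qed.

(** * Morphisms between discretizations and their extension to real degrees *)

Section Grids.
Variables (k : fieldType) (R : realType).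
Implicit Types M N : persMod k R.

(* A morphism of degree [s] between the [t]-discretizations of [M] and [N]. *)
Record gridmap (t : grid R) (s : int) M N (F : int -> M -> N) : Prop := {
  grm_part : forall z x, pm_part (t z) x -> pm_part (t (z + s)) (F z x);
  grm_linear : forall z (c : k) x y, pm_part (t z) x -> pm_part (t z) y ->
    F z (constB R c *: x + y) = constB R c *: F z x + F z y;
  grm_xp : forall y z x, y <= z -> pm_part (t y) x ->
    F z (xp k (t z - t y) *: x) = xp k (t (z + s) - t (y + s)) *: F y x }.

Lemma gridmap_transport (t : grid R) (s : int) M N (D1 D2 : diagram int)
    (th1 : int -> (bar_index D1 -> k) -> M)
    (th2 : int -> (bar_index D2 -> k) -> N)
    (T : int -> (bar_index D1 -> k) -> (bar_index D2 -> k)) :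
  (forall z, set_bij (@isum_part k D1 z) (@pm_part _ _ M (t z)) (th1 z)) ->
  (forall z (c : k) v w, isum_part z v -> isum_part z w ->
    th1 z (fun i => c * v i + w i) = constB R c *: th1 z v + th1 z w) ->
  (forall y z (yz : y <= z) v, isum_part y v ->
    th1 z (isum_trans z v) = phi (grid_le t yz) (th1 y v)) ->
  (forall z, set_bij (@isum_part k D2 z) (@pm_part _ _ N (t z)) (th2 z)) ->
  (forall z (c : k) v w, isum_part z v -> isum_part z w ->
    th2 z (fun i => c * v i + w i) = constB R c *: th2 z v + th2 z w) ->
  (forall y z (yz : y <= z) v, isum_part y v ->
    th2 z (isum_trans z v) = phi (grid_le t yz) (th2 y v)) ->
  (forall z v, isum_part z v -> isum_part (z + s) (T z v)) ->
  (forall z c v w,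
    T z (fun i => c * v i + w i) = (fun j => c * T z v j + T z w j)) ->
  (forall y z v, y <= z -> isum_part y v ->
    T z (isum_trans z v) = isum_trans (z + s) (T y v)) ->
  exists2 F, gridmap t s F &
    forall z v, isum_part z v -> F z (th1 z v) = th2 (z + s) (T z v).
Proof.
move=> bij1 lin1 tr1 bij2 lin2 tr2 Tpart Tlin Ttr.
have ex (zx : int * M) : exists v, pm_part (t zx.1) zx.2 ->
    isum_part zx.1 v /\ th1 zx.1 v = zx.2.
  case: zx => z x /=; have [zx|nzx] := pselect (pm_part (t z) x); last first.
    by exists (fun=> 0) => /nzx.
  have [_ _ surj] := bij1 z.
  by have [v vz vx] := surj x zx; exists v.
(* [inv] inverts [th1] degree by degree, so that [T] can be conjugated by the two decompositions. *)
have [inv invP] := choice ex.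
have th1_part z v : isum_part z v -> pm_part (t z) (th1 z v).
  by move=> zv; have [h _ _] := bij1 z; apply: h.
have FE z v : isum_part z v ->
    th2 (z + s) (T z (inv (z, th1 z v))) = th2 (z + s) (T z v).
  move=> zv; have [zv' vE] := invP (z, th1 z v) (th1_part _ _ zv).
  congr (th2 _ (T z _)); have [_ inj _] := bij1 z.
  by apply: inj => //; rewrite inE.
exists (fun z x => th2 (z + s) (T z (inv (z, x)))) => //.
have lift z x : pm_part (t z) x -> exists2 v, isum_part z v & x = th1 z v.
  move=> zx; have [_ _ surj] := bij1 z.
  by have [v vz vx] := surj x zx; exists v.
have zvw z c (v w : bar_index D1 -> k) : isum_part z v -> isum_part z w ->
    isum_part z (fun i => c * v i + w i).
  move=> [vfin v0] [wfin w0]; split; last first.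
    by move=> i iz; rewrite v0 // w0 // mulr0 addr0.
  have vw : finite_set ([set i | v i != 0] `|` [set i | w i != 0]).
    by rewrite finite_setU.
  apply: (sub_finite_set _ vw) => i /= h.
  have [vi|vi] := eqVneq (v i) 0; last by left.
  by right; apply: contraNneq h => wi; rewrite vi wi mulr0 addr0.
split.
- move=> z x /lift[v zv ->]; rewrite FE //.
  by have [h _ _] := bij2 (z + s); apply: h; apply: Tpart.
- move=> z c x y /lift[v zv ->] /lift[w zw ->].
  rewrite -lin1 // !FE //; last exact: zvw.
  by rewrite Tlin lin2 //; apply: Tpart.
- move=> y z x yz /lift[v yv ->].
  have zv : isum_part z (isum_trans z v).
    case: yv => vfin v0; split=> [|i iz]; last first.
      by rewrite /isum_trans (negPf iz).
    apply: sub_finite_set vfin => i /=; rewrite /isum_trans.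
    by case: ifP => //; rewrite eqxx.
  rewrite -(phiE (grid_le t yz)) -tr1 // !FE // (Ttr y z v yz yv).
  have yzs : y + s <= z + s by rewrite lerD2r.
  by rewrite (tr2 _ _ yzs) ?phiE //; apply: Tpart.
Qed.


Lemma gridmaps_of_barmaps (t : grid R) (s : int) M N (D1 D2 : diagram int)
    (pr : bar_index D2 -> option (bar_index D1))
    (pl : bar_index D1 -> option (bar_index D2)) :
  0 <= s ->
  discretization_decomposes M t D1 -> discretization_decomposes N t D2 ->
  (forall i j, pl i = Some j <-> pr j = Some i) ->
  (forall i j, pr j = Some i -> near_bars s i j) ->
  (forall i, pl i = None -> before (val (tag i)).1 (val (tag i)).2 (s + s)) ->
  (forall j, pr j = None -> before (val (tag j)).1 (val (tag j)).2 (s + s)) ->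
  exists F G, [/\ @gridmap t s M N F, @gridmap t s N M G,
    forall z x, pm_part (t z) x ->
      G (z + s) (F z x) = xp k (t (z + s + s) - t z) *: x &
    forall z x, pm_part (t z) x ->
      F (z + s) (G z x) = xp k (t (z + s + s) - t z) *: x].
Proof.
move=> s0 [th1 [bij1 lin1 tr1]] [th2 [bij2 lin2 tr2]] plr near shortl shortr.
have plr1 i j : pl i = Some j -> pr j = Some i by move/plr.
have plr2 j i : pr j = Some i -> pl i = Some j by move/plr.
have near' j i : pl i = Some j -> near_bars s j i.
  by move=> /plr1/near/near_bars_sym.
have inj1 i j j' : pr j = Some i -> pr j' = Some i -> j = j'.
  by move=> /plr2 ij /plr2; rewrite ij => -[].
have inj2 j i i' : pl i = Some j -> pl i' = Some j -> i = i'.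
  by move=> /plr1 ij /plr1; rewrite ij => -[].
have [F FP FE] := gridmap_transport bij1 lin1 tr1 bij2 lin2 tr2
  (@barmap_part k _ _ _ _ inj1) (@barmap_linear k _ _ s pr)
  (@barmap_trans k _ _ _ _ near).
have [G GP GE] := gridmap_transport bij2 lin2 tr2 bij1 lin1 tr1
  (@barmap_part k _ _ _ _ inj2) (@barmap_linear k _ _ s pl)
  (@barmap_trans k _ _ _ _ near').
exists F, G; split => // z x zx.
- have [_ _ /(_ x zx)[v zv <-]] := bij1 z.
  have zss : z <= z + s + s by rewrite -addrA lerDl addr_ge0.
  rewrite FE // GE; last exact: barmap_part.
  by rewrite (barmap_comp s0 plr1 near shortl zv) (tr1 _ _ zss) ?phiE.
- have [_ _ /(_ x zx)[v zv <-]] := bij2 z.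
  have zss : z <= z + s + s by rewrite -addrA lerDl addr_ge0.
  rewrite GE // FE; last exact: barmap_part.
  by rewrite (barmap_comp s0 plr2 near' shortr zv) (tr2 _ _ zss) ?phiE.
Qed.

Section Extension.
Variables (t : grid R) (s : int) (e : R) (cl : R -> int).
Hypothesis s0 : 0 <= s.
Hypothesis cl_ge : forall a, a <= t (cl a).
Hypothesis cl_mono : forall a b, a <= b -> cl a <= cl b.
Hypothesis cl_le : forall a, t (cl a + s) <= a + e.

(** The degree is rounded up to the grid, [F] is applied there, and the remaining distance to
    [a + e], nonnegative by [cl_le], is made up by a transition map. *)
Definition grid_extend M N (F : int -> M -> N) (a : R) (x : M) : N :=
  xp k (a + e - t (cl a + s)) *: F (cl a) (xp k (t (cl a) - a) *: x).

Lemma grid_extend_gradedmap M N (F : int -> M -> N) :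
  gridmap t s F -> gradedmap e (grid_extend F).
Proof.
move=> FP; split.
- move=> a x ax; apply: pm_part_xp => //; apply: (grm_part FP).
  exact: pm_part_xp.
- move=> a c x y ax ay; rewrite /grid_extend scalerDr scalerA mulrC -scalerA.
  rewrite (grm_linear FP); try exact: pm_part_xp.
  by rewrite scalerDr !scalerA [xp _ _ * _]mulrC.
- move=> a b x ab ax; rewrite /grid_extend.
  have clab := cl_mono ab.
  have tab := grid_le t clab.
  have tabs : t (cl a + s) <= t (cl b + s) by apply: grid_le; rewrite lerD2r.
  have -> : xp k (t (cl b) - b) *: (xp k (b - a) *: x)
      = xp k (t (cl b) - t (cl a)) *: (xp k (t (cl a) - a) *: x).
    by rewrite !scale_xpD ?subr_ge0 //; apply: scale_xp_eq; ring.
  rewrite (grm_xp FP) //; last exact: pm_part_xp.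
  by rewrite !scale_xpD ?subr_ge0 //; apply: scale_xp_eq; ring.
Qed.

Lemma grid_extend_comp M N (F : int -> M -> N) (G : int -> N -> M) :
  gridmap t s F -> gridmap t s G ->
  (forall z x, pm_part (t z) x ->
      G (z + s) (F z x) = xp k (t (z + s + s) - t z) *: x) ->
  forall a x, pm_part a x ->
    grid_extend G (a + e) (grid_extend F a x) = xp k (e + e) *: x.
Proof.
move=> FP GP GF a x ax; rewrite /grid_extend.
set z := cl a; set w := cl (a + e); set x1 := _ *: x.
have zx1 : pm_part (t z) x1 by apply: pm_part_xp.
have ae := cl_ge (a + e); rewrite -/w in ae.
have zae := cl_le a; rewrite -/z in zae.
have waee := cl_le (a + e); rewrite -/w in waee.
(* The first map ends at the grid point [t (z + s)], at most [a + e], so rounding [a + e] up cannot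
   fall short of it. [G] can then be moved back to index [z + s], and the exponents telescope. *)
have zsw : z + s <= w.
  by rewrite leNgt; apply/negP => /(grid_incr t); rewrite ltNge (le_trans zae).
have zssws : t (z + s + s) <= t (w + s) by apply: grid_le; rewrite lerD2r.
have zzss : t z <= t (z + s + s).
  by apply: grid_le; rewrite -addrA lerDl addr_ge0.
have az := cl_ge a; rewrite -/z in az.
rewrite scale_xpD ?subr_ge0 // addrA subrK (grm_xp GP) //; last first.
  exact: (grm_part FP).
rewrite GF // /x1.
have h1 : 0 <= a + e + e - t (w + s) by rewrite subr_ge0.
have h2 : 0 <= t (w + s) - t (z + s + s) by rewrite subr_ge0.
have h3 : 0 <= t (z + s + s) - t z by rewrite subr_ge0.
have h4 : 0 <= t z - a by rewrite subr_ge0.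
rewrite (scale_xpD _ h1 h2) (scale_xpD _ (addr_ge0 h1 h2) h3).
rewrite (scale_xpD _ (addr_ge0 (addr_ge0 h1 h2) h3) h4).
by apply: scale_xp_eq; ring.
Qed.

End Extension.

End Grids.

Lemma option_of_relation (I J : Type) (S : I -> J -> Prop) :
  (forall i j j', S i j -> S i j' -> j = j') ->
  exists f : I -> option J, forall i j, f i = Some j <-> S i j.
Proof.
move=> Sfun.
have ex (i : I) : exists o : option J, forall j, o = Some j <-> S i j.
  have [[j ij]|ni] := pselect (exists j, S i j).
    by exists (Some j) => j'; split=> [[<-]//|/(Sfun _ _ _ ij) ->].
  by exists None => j; split=> // ij; case: ni; exists j.
by have [f fE] := choice ex; exists f.
Qed.

(** * From matchings of real diagrams to partner maps of integer bars *)

Section Bars.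
Variable R : realType.
Variable t : grid R.

Lemma grid_leE (y z : int) : (t y <= t z) = (y <= z).
Proof.
apply/idP/idP => [|/grid_le//]; apply: contraTT; rewrite -!ltNge.
exact: grid_incr.
Qed.

Lemma er_map_grid_le (x : \bar int) (z : int) :
  (er_map t x <= (t z)%:E)%E = (x <= z%:E)%E.
Proof. by case: x => [r||] /=; rewrite ?lee_fin ?grid_leE ?leye_eq ?leNye. Qed.

Lemma er_map_grid_inj : injective (er_map t).
Proof.
move=> [x||] [y||] //= [] xy; congr (_%:E); apply/eqP.
by rewrite eq_le -!grid_leE xy lexx.
Qed.

Lemma er_map_grid_lt (x y : \bar int) :
  (x < y)%E -> (er_map t x < er_map t y)%E.
Proof.
case: x y => [x||] [y||] //=; rewrite ?ltry ?ltNyr // !lte_fin.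
exact: grid_incr.
Qed.

(** Strict monotonicity of the grid makes endpoints injective, and [E] is supported on their image,
    so bars of [D] and of [E] correspond one to one. *)
Lemma bar_codes (D : diagram int) (E : diagram R) :
  (forall (p : upper int) (q : upper R),
     val q = (er_map t (val p).1, er_map t (val p).2) -> E q = D p) ->
  (forall q : upper R, dsupp E q ->
     exists2 p, dsupp D p & val q = (er_map t (val p).1, er_map t (val p).2)) ->
  exists code : bar_index D -> upper R * nat,
  [/\ injective code,
      forall i, val (code i).1
        = (er_map t (val (tag i)).1, er_map t (val (tag i)).2),
      forall i, ((code i).2 < E (code i).1)%N &
      forall u, (u.2 < E u.1)%N -> exists i, code i = u].
Proof.
move=> ED Esupp.
have ex (p : upper int) : exists q : upper R,
    val q = (er_map t (val p).1, er_map t (val p).2).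
  by exists (exist _ (er_map t (val p).1, er_map t (val p).2)
    (er_map_grid_lt (valP p))).
have [q qE] := choice ex.
have q_inj : injective q.
  move=> p p' pp'; apply: val_inj; have := qE p; rewrite pp' qE => -[].
  move=> /er_map_grid_inj h1 /er_map_grid_inj h2.
  by rewrite [val p]surjective_pairing [val p']surjective_pairing h1 h2.
exists (fun i => (q (tag i), nat_of_ord (tagged i))); split.
- move=> [p n] [p' n'] /= [/q_inj pp' nn']; subst p'.
  by congr existT; apply: val_inj.
- by move=> i; apply: qE.
- by move=> [p n] /=; rewrite (ED _ _ (qE p)).
- move=> [x n] /= nx.
  have /Esupp[p _ xE] : dsupp E x by rewrite /dsupp /= -lt0n; lia.
  have nD : (n < D p)%N by rewrite -(ED _ _ xE).
  exists (existT _ p (Ordinal nD)) => /=; congr (_, _).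
  by apply: val_inj; rewrite qE.
Qed.

(** As [s] grid steps advance by at least [c], a real error [c] becomes an integer error [s]. *)
Lemma before_er_map (s : int) (c : R) (x y : \bar int) :
  (forall z, t z + c <= t (z + s)) ->
  (er_map t y <= er_map t x + c%:E)%E -> before x y s.
Proof.
move=> tc yx z; rewrite -!er_map_grid_le => xz.
apply: (le_trans yx); apply: (le_trans (leeD2r _ xz)).
by rewrite -EFinD lee_fin.
Qed.

Lemma barmaps_of_matching (s : int) (c : R) (D1 D2 : diagram int)
    (E1 E2 : diagram R) (code1 : bar_index D1 -> upper R * nat)
    (code2 : bar_index D2 -> upper R * nat)
    rho :
  (forall z, t z + c <= t (z + s)) ->
  injective code1 ->
  (forall i, val (code1 i).1
     = (er_map t (val (tag i)).1, er_map t (val (tag i)).2)) ->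
  (forall i, ((code1 i).2 < E1 (code1 i).1)%N) ->
  (forall u, (u.2 < E1 u.1)%N -> exists i, code1 i = u) ->
  injective code2 ->
  (forall i, val (code2 i).1
     = (er_map t (val (tag i)).1, er_map t (val (tag i)).2)) ->
  (forall i, ((code2 i).2 < E2 (code2 i).1)%N) ->
  (forall u, (u.2 < E2 u.1)%N -> exists i, code2 i = u) ->
  matching c E1 E2 rho ->
  exists (pr : bar_index D2 -> option (bar_index D1))
         (pl : bar_index D1 -> option (bar_index D2)),
  [/\ forall i j, pl i = Some j <-> pr j = Some i,
      forall i j, pr j = Some i -> near_bars s i j,
      forall i, pl i = None -> before (val (tag i)).1 (val (tag i)).2 (s + s) &
      forall j, pr j = None -> before (val (tag j)).1 (val (tag j)).2 (s + s)].
Proof.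
move=> tc inj1 val1 bar1 surj1 inj2 val2 bar2 surj2 [mb mn mf mi ml mr].
pose S i j := rho (code1 i) (code2 j).
have [pl plE] : exists f : bar_index D1 -> option (bar_index D2),
    forall i j, f i = Some j <-> S i j.
  by apply: option_of_relation => i j j' ij ij'; apply/inj2/(mf _ _ _ ij ij').
have [pr prE] : exists f : bar_index D2 -> option (bar_index D1),
    forall j i, f j = Some i <-> S i j.
  by apply: option_of_relation => j i i' ij ij'; apply/inj1/(mi _ _ _ ij ij').
have tcc z : t z + (c + c) <= t (z + (s + s)).
  by rewrite !addrA (le_trans _ (tc _)) // lerD2r.
exists pr, pl; split.
- by move=> i j; rewrite plE prE.
- move=> i j /prE /mn; rewrite val1 val2 => -[/= n1 n2 n3 n4].
  by split; apply: before_er_map tc _.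
- move=> i pi; apply: (before_er_map tcc).
  have [[v iv]|] := ml _ (bar1 i); last by rewrite val1.
  have [_ /surj2[j vE]] := mb _ _ iv.
  by move: iv; rewrite -vE => /plE; rewrite pi.
- move=> j pj; apply: (before_er_map tcc).
  have [[u uj]|] := mr _ (bar2 j); last by rewrite val2.
  have [/surj1[i uE] _] := mb _ _ uj.
  by move: uj; rewrite -uE => /prE; rewrite pj.
Qed.

End Bars.

(** * Uniform grids *)

Section UniformGrid.
Variables (R : realType) (h : R).
Hypothesis h0 : 0 < h.

Lemma uniform_grid_incr (y z : int) : y < z -> y%:~R * h < z%:~R * h.
Proof. by move=> yz; rewrite ltr_pM2r // ltr_int. Qed.

Lemma uniform_grid_discrete :
  limit_point (range (fun z : int => z%:~R * h)) = set0.
Proof.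
apply/seteqP; split=> // x /= lim.
have near r : 0 < r -> exists z : int, z%:~R * h != x /\ `|x - z%:~R * h| < r.
  move=> r0; have [y [yx [z _ zy]] xy] := lim _ (nbhsx_ballx x _ r0).
  by exists z; rewrite zy.
(* Near an accumulation point there is a grid point within [h / 2], and a second one strictly
   closer; they are distinct but less than [h] apart, a contradiction. *)
have h20 : 0 < h / 2 by rewrite divr_gt0.
have [y [yx xy]] := near _ h20.
have d0 : 0 < `|x - y%:~R * h| by rewrite normr_gt0 subr_eq0 eq_sym.
have m0 : 0 < Num.min `|x - y%:~R * h| (h / 2) by rewrite lt_min d0.
have [z [zx]] := near _ m0; rewrite lt_min => /andP[xz1 xz2].
have [yz|yz] := eqVneq y z; first by rewrite yz ltxx in xz1.
have : `|(y - z)%:~R * h| < h.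
  rewrite intrB mulrBl; have -> : y%:~R * h - z%:~R * h
    = (x - z%:~R * h) - (x - y%:~R * h) by ring.
  by have := ler_normB (x - z%:~R * h) (x - y%:~R * h); lra.
apply/negP; rewrite -leNgt normrM (gtr0_norm h0) ler_peMl ?(ltW h0) //.
by rewrite -intr_norm ler1z; lia.
Qed.

Definition uniform_grid : grid R :=
  Grid uniform_grid_incr uniform_grid_discrete.

Lemma uniform_grid_ceil (a : R) :
  a <= uniform_grid (Num.ceil (a / h)) /\
  uniform_grid (Num.ceil (a / h)) <= a + h.
Proof.
have := ceil_itv (a / h); rewrite ltr_pdivlMr // ler_pdivrMr // => /andP[lt le].
split=> //=; move: lt; rewrite intrB mulrBl mul1r => /ltW.
by rewrite lerBlDr.
Qed.

Lemma uniform_grid_cover : is_cover h uniform_grid.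
Proof.
move=> x; exists (Num.ceil (x / h)); have [le le'] := uniform_grid_ceil x.
rewrite ler_distl lerBlDr le' /=.
by rewrite (le_trans le) // lerDl ltW.
Qed.

End UniformGrid.

(** * Interleavings from the bottleneck distance *)

Lemma interleaved_of_matching (k : fieldType) (R : realType) (M N : persMod k R)
    (t : grid R) (s : int) (c : R) (e : {nonneg R}) (cl : R -> int)
    (E1 E2 : diagram R) rho :
  0 <= s -> (forall z, t z + c <= t (z + s)) ->
  (forall a, a <= t (cl a)) -> (forall a b, a <= b -> cl a <= cl b) ->
  (forall a, t (cl a + s) <= a + e%:num) ->
  discretization_diagram M t E1 -> discretization_diagram N t E2 ->
  matching c E1 E2 rho -> interleaved e M N.
Proof.
move=> s0 tc cl_ge cl_mono cl_le.
move=> [D1 [dec1 [ED1 supp1]]] [D2 [dec2 [ED2 supp2]]] rhoP.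
have [code1 [inj1 val1 bar1 surj1]] := bar_codes ED1 supp1.
have [code2 [inj2 val2 bar2 surj2]] := bar_codes ED2 supp2.
have [pr [pl [plr near shortl shortr]]] := barmaps_of_matching tc
  inj1 val1 bar1 surj1 inj2 val2 bar2 surj2 rhoP.
have [F [G [FP GP GF FG]]] :=
  gridmaps_of_barmaps s0 dec1 dec2 plr near shortl shortr.
apply: (interleaved_gradedmaps (grid_extend_gradedmap cl_ge cl_mono cl_le FP)
  (grid_extend_gradedmap cl_ge cl_mono cl_le GP)).
- by move=> a x; apply: grid_extend_comp.
- by move=> a x; apply: grid_extend_comp.
Qed.

Lemma interleaved_of_bottleneck (k : fieldType) (R : realType)
    (M N : persMod k R) (DM DN : diagram R) (eps : {nonneg R})
    (delta : {posnum R}) :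
  persistence_diagram M DM -> persistence_diagram N DN ->
  bottleneck DM DN = (eps%:num)%:E ->
  interleaved (eps%:num + delta%:num)%:nng M N.
Proof.
move=> hM hN hd.
have h0 i : 0 < 2^-1 ^+ i :> R by rewrite exprn_gt0.
pose t i := uniform_grid (h0 i).
have tcover i : (0 < i)%N -> is_cover (2^-1 ^+ i) (t i).
  by move=> _; apply: uniform_grid_cover.
have [EM [dM limM]] := hM t tcover.
have [EN [dN limN]] := hN t tcover.
(* There are five errors below or equal to [d]: one for each discretization, one to make the bound
   on [bottleneck DM DN] strict, and one mesh each for rounding the degree and the shift [c] up to
   the grid. *)
pose d : R := delta%:num / 5.
have d0 : 0 < d by rewrite divr_gt0.
have small (E : nat -> diagram R) D : bottleneck (E i) D @[i --> \oo] --> 0%E ->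
    \forall i \near \oo, (bottleneck (E i) D < d%:E)%E.
  have nb : nbhs (0%E : \bar R) [set y | (y < d%:E)%E].
    apply: open_nbhs_nbhs; split; first exact: open_ereal_lt_ereal.
    by rewrite /= lte_fin.
  by move=> lim; apply: lim nb.
have hlim : \forall i \near \oo, 2^-1 ^+ i < d.
  apply: cvgr_lt d0; apply: cvg_expr.
  by rewrite ger0_norm ?invr_ge0 // invf_lt1 // ltr1n.
have [i [i0 hd_lt M_lt N_lt]] : exists i, [/\ (0 < i)%N, 2^-1 ^+ i < d,
    (bottleneck (EM i) DM < d%:E)%E & (bottleneck (EN i) DN < d%:E)%E].
  have iN0 : \forall i \near \oo, (0 < i)%N by exact: nbhs_infty_gt.
  apply: (@filter_ex _ \oo).
  by near=> i; split; near: i;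
    [exact: iN0|exact: hlim|exact: small limM|exact: small limN].
have eps0 : 0 <= eps%:num :> R by [].
have ed0 : 0 <= eps%:num + d by rewrite addr_ge0 // ltW.
have [rM rMP] := bottleneck_matching (ltW d0) M_lt.
have [rN rNP] := bottleneck_matching (ltW d0) N_lt.
have DMN : (bottleneck DM DN < (eps%:num + d)%:E)%E by rewrite hd lte_fin ltrDl.
have [r rP] := bottleneck_matching ed0 DMN.
(* The matchings are composed along [EM i], [DM], [DN], [EN i]. *)
have rhoP := matching_trans (addr_ge0 (ltW d0) ed0) (ltW d0)
  (matching_trans (ltW d0) ed0 rMP rP) (matching_sym rNP).
pose h : R := 2^-1 ^+ i; pose c := d + (eps%:num + d) + d.
have hi0 : 0 < h := h0 i.
have c0 : 0 <= c by rewrite /c !addr_ge0 // ltW.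
pose s := Num.ceil (c / h).
have [cs sc] := uniform_grid_ceil hi0 c.
rewrite -/s /= in cs sc.
have tE z : t i z = z%:~R * h by [].
apply: (@interleaved_of_matching _ _ _ _ (t i) s c _ (fun a => Num.ceil (a / h))
  (EM i) (EN i)).
- by rewrite /s ceil_ge0 (lt_le_trans (ltrN10 _)) // divr_ge0 // ltW.
- by move=> z; rewrite !tE intrD mulrDl lerD2l.
- by move=> a; have [] := uniform_grid_ceil hi0 a.
- by move=> a b ab; apply: le_ceil; rewrite ler_pM2r ?invr_gt0.
- move=> a; have [_] := uniform_grid_ceil hi0 a.
  rewrite !tE intrD mulrDl /= => ah.
  have := hd_lt; rewrite -/h => hd'; rewrite /c /d in sc hd'; lra.
- exact: dM.
- exact: dN.
- exact: rhoP.
Unshelve. all: by end_near.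
Qed.

Theorem corollary2p5p3 (k : fieldType) (R : realType) (M N : persMod k R)
    (DM DN : diagram R) (eps : {nonneg R})
    (hM : persistence_diagram M DM) (hN : persistence_diagram N DN)
    (hd : bottleneck DM DN = (eps%:num)%:E) :
  (finitely_presented M -> finitely_presented N -> interleaved eps M N) /\
  (tame M -> tame N ->
     forall delta : {posnum R},
       interleaved (eps%:num + delta%:num)%:nng M N).
Proof.
have I delta := interleaved_of_bottleneck delta hM hN hd.
split=> [/finitely_presented_critical_values[U UM] | _ _ //].
move=> /finitely_presented_critical_values[V VN].
exact: interleaved_closure UM VN I.
Qed.
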